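(* Let $\Sigma$ be a finite ranked set. If a language $L\subseteq\mathsf{H}_0\Sigma$ is definable in counting $\mathrm{MSO}_2$, then it is recognised by a computable $\mathsf{H}$-algebra that is finite on every arity.
   Context: A ranked set is a set in which each element has an arity in $\{0,1,2,\dots\}$. A sourced hypergraph of arity $n$ over $\Sigma$: finite vertex set, finite ranked set of hyperedges labelled arity-preservingly by $\Sigma$, incidence mapping each $m$-ary hyperedge $e$ to a non-repeating list $e[1],\dots,e[m]$ of vertices, injective sources $\{1,\dots,n\}\to$ vertices. $\mathsf{H}\Sigma$: these up to isomorphism; $\mathsf{H}_0\Sigma$: arity 0. Unit of $n$-ary $a$: vertices $1..n$ as sources, one hyperedge labelled $a$ with incidence $[1..n]$. Flattening of $G\in\mathsf{H}\mathsf{H}\Sigma$: hyperedges $(e,f)$, $e$ a hyperedge of $G$, $f$ a hyperedge of the label of $e$ (label from $f$); vertices: vertices of $G$ and pairs $(e,v)$, $v$ a non-source vertex of the label of $e$; sources from $G$; incidence of $(e,f)$ is that of $f$ with $v\mapsto(e,v)$ for non-sources and $v\mapsto e[i]$ for the $i$-th source. An $\mathsf{H}$-algebra is a ranked set $A$ with arity-preserving $\pi:\mathsf{H}A\to A$, $\pi(\mathrm{unit}\,a)=a$, $\pi\circ\mathsf{H}\pi=\pi\circ\mathrm{flatten}$; homomorphisms commute with products. $L$ is recognised by $\mathcal{A}$ if $L=h^{-1}(F)\cap\mathsf{H}_0\Sigma$ for a homomorphism $h:\mathsf{H}\Sigma\to\mathcal{A}$ and a set $F$. An $\mathsf{H}$-algebra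 with universe $A$ is computable if its elements can be represented finitely (e.g. as strings) so that there are algorithms that (1) given an arity $n$ and $i\ge1$, compute the $i$-th $n$-ary element or report that there are fewer than $i$ of them; (2) given an element of $\mathsf{H}A$, compute its product. The $\mathrm{MSO}_2$ model of $G\in\mathsf{H}\Sigma$: universe is the disjoint union of vertices and hyperedges; for each $a\in\Sigma$ a unary relation for hyperedges labelled $a$; for each $i$ up to the maximal arity in $\Sigma$ a binary relation $\{(e,v): e[i]=v\}$; for each $i$ up to the arity of $G$ a constant for the $i$-th source. Counting MSO is MSO extended with predicates $|X|\equiv k \bmod m$ (true if $X$ is finite with size $\equiv k$ mod $m$). $L$ is definable in counting $\mathrm{MSO}_2$ if $L=\{G\in\mathsf{H}_0\Sigma : \text{model of } G\models\varphi\}$ for a counting MSO sentence $\varphi$. *)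

(* Defs.v *)
From HB Require Import structures.
From mathcomp Require Import all_boot.
Set Implicit Arguments. Unset Strict Implicit. Unset Printing Implicit Defensive.

(* Sourced hypergraphs (raw presentations; everything is taken up to iso).   *)
(* A ranked set is a type A together with an arity function ar : A -> nat.   *)
(* The record below carries the raw data; well-formedness (incidence lists   *)
(* are non-repeating of the right length, sources are injective) is the      *)
(* separate predicate [hwf ar].  The arity of a hypergraph is the number of  *)
(* its sources.  Incidence lists and source lists are 0-indexed seqs, the    *)
(* i-th entry (1-based, as in the paper) being [nth _ s (i-1)].              *)

Record hgraph (A : Type) := HG {
  hV : finType;
  hE : finType;
  hlab : hE -> A;
  hinc : hE -> seq hV;
  hsrc : seq hV
}.

Arguments hlab {A} h _.
Arguments hinc {A} h _.
Arguments hsrc {A} h.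
Arguments hV {A} h.
Arguments hE {A} h.

Definition harity (A : Type) (G : hgraph A) : nat := size (hsrc G).

Definition hwf (A : Type) (ar : A -> nat) (G : hgraph A) : Prop :=
  uniq (hsrc G) /\
  (forall e, uniq (hinc G e) /\ size (hinc G e) = ar (hlab G e)).

Definition hwf2 (A : Type) (ar : A -> nat) (G : hgraph (hgraph A)) : Prop :=
  hwf (@harity A) G /\ (forall e, hwf ar (hlab G e)).

Definition hiso (A : Type) (G H : hgraph A) : Prop :=
  exists (fv : hV G -> hV H) (fe : hE G -> hE H),
    bijective fv /\ bijective fe /\
    (forall e, hlab H (fe e) = hlab G e) /\
    (forall e, hinc H (fe e) = map fv (hinc G e)) /\
    hsrc H = map fv (hsrc G).

Definition hmap (A B : Type) (f : A -> B) (G : hgraph A) : hgraph B :=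
  @HG B (hV G) (hE G) (fun e => f (hlab G e)) (hinc G) (hsrc G).

Definition hunit (A : Type) (ar : A -> nat) (a : A) : hgraph A :=
  @HG A 'I_(ar a) unit (fun _ => a) (fun _ => enum 'I_(ar a)) (enum 'I_(ar a)).

Section Flatten.
Variables (A : Type) (G : hgraph (hgraph A)).

Definition inner (e : hE G) : hgraph A := hlab G e.

Definition nonsrc (e : hE G) : finType :=
  {v : hV (inner e) | v \notin hsrc (inner e)}.

Definition flatV : finType := (hV G + {e : hE G & nonsrc e})%type.
Definition flatE : finType := {e : hE G & hE (inner e)}.

Definition flat_vert (e : hE G) (v : hV (inner e)) : option flatV :=
  match (insub v : option (nonsrc e)) with
  | Some w => Some (inr (existT _ e w))
  | None => omap inl (nth None (map Some (hinc G e)) (index v (hsrc (inner e))))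
  end.

Definition flatten : hgraph A :=
  @HG A flatV flatE
    (fun x => hlab (inner (tag x)) (tagged x))
    (fun x => pmap (@flat_vert (tag x)) (hinc (inner (tag x)) (tagged x)))
    (map inl (hsrc G)).
End Flatten.

(* H-algebras: the product is given on raw presentations and must be
   invariant under isomorphism (i.e. it is a map on H A). *)
Definition is_Halg (A : Type) (ar : A -> nat) (pi : hgraph A -> A) : Prop :=
  (forall G, hwf ar G -> ar (pi G) = harity G) /\
  (forall G H, hwf ar G -> hiso G H -> pi G = pi H) /\
  (forall a, pi (hunit ar a) = a) /\
  (forall G : hgraph (hgraph A), hwf2 ar G -> pi (hmap pi G) = pi (flatten G)).

Definition is_hom_free (S : Type) (arS : S -> nat)
    (A : Type) (ar : A -> nat) (pi : hgraph A -> A) (h : hgraph S -> A) : Prop :=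
  (forall G, hwf arS G -> ar (h G) = harity G) /\
  (forall G H, hwf arS G -> hiso G H -> h G = h H) /\
  (forall G : hgraph (hgraph S), hwf2 arS G -> h (flatten G) = pi (hmap h G)).

Definition recognises (S : Type) (arS : S -> nat) (L : hgraph S -> Prop)
    (A : Type) (ar : A -> nat) (pi : hgraph A -> A) : Prop :=
  exists h : hgraph S -> A, is_hom_free arS ar pi h /\
  exists F : A -> Prop,
    forall G, hwf arS G -> harity G = 0 -> (L G <-> F (h G)).

Definition finite_on_every_arity (A : Type) (ar : A -> nat) : Prop :=
  forall n, exists (k : nat) (f : 'I_k -> A), forall a, ar a = n -> exists i, f i = a.

Inductive recf : nat -> Type :=
| rZero k : recf k
| rSucc : recf 1
| rProj k (i : 'I_k) : recf k
| rComp k m : recf m -> recfs k m -> recf k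
| rPrec k : recf k -> recf k.+2 -> recf k.+1
| rMin k : recf k.+1 -> recf k
with recfs : nat -> nat -> Type :=
| rnil k : recfs k 0
| rcons k m : recf k -> recfs k m -> recfs k m.+1.

Inductive eval : forall k, recf k -> seq nat -> nat -> Prop :=
| ev_zero k xs : size xs = k -> eval (rZero k) xs 0
| ev_succ x : eval rSucc [:: x] x.+1
| ev_proj k (i : 'I_k) xs : size xs = k -> eval (rProj i) xs (nth 0 xs i)
| ev_comp k m (f : recf m) (gs : recfs k m) xs ys y :
    evals gs xs ys -> eval f ys y -> eval (rComp f gs) xs y
| ev_prec0 k (f : recf k) (g : recf k.+2) xs y :
    eval f xs y -> eval (rPrec f g) (0 :: xs) y
| ev_precS k (f : recf k) (g : recf k.+2) n xs z y :
    eval (rPrec f g) (n :: xs) z -> eval g (n :: z :: xs) y ->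
    eval (rPrec f g) (n.+1 :: xs) y
| ev_min k (f : recf k.+1) xs y :
    eval f (y :: xs) 0 ->
    (forall z, z < y -> exists w, eval f (z :: xs) w.+1) ->
    eval (rMin f) xs y
with evals : forall k m, recfs k m -> seq nat -> seq nat -> Prop :=
| evs_nil k xs : evals (rnil k) xs [::]
| evs_cons k m (f : recf k) (gs : recfs k m) xs y ys :
    eval f xs y -> evals gs xs ys -> evals (rcons f gs) xs (y :: ys).

Definition cpair (x y : nat) : nat := (x + y) * (x + y).+1 %/ 2 + y.
Definition enc_list (s : seq nat) : nat := foldr (fun x n => (cpair x n).+1) 0 s.

(* encoding of a presentation: number of vertices, source list, and the list
   of hyperedges (code of label, incidence list); vertices are 0..nv-1 *)
Definition enc_hg (nv : nat) (src : seq nat) (edges : seq (nat * seq nat)) : nat :=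
  cpair nv (cpair (enc_list src)
                  (enc_list (map (fun p => cpair p.1 (enc_list p.2)) edges))).

(* [n] is a string (number) representing the element G of H A, given the
   representation [code] of the elements of A: any numbering of the vertices
   by 0..|V|-1 and any ordering of the hyperedges. *)
Definition represents (A : Type) (code : A -> nat) (G : hgraph A) (n : nat) : Prop :=
  exists (fv : hV G -> nat) (es : seq (hE G)),
    injective fv /\ (forall v, fv v < #|hV G|) /\
    uniq es /\ (forall e, e \in es) /\
    n = enc_hg #|hV G| (map fv (hsrc G))
              (map (fun e => (code (hlab G e), map fv (hinc G e))) es).

(* A computable H-algebra: injective representation of elements by numbers,
   (1) a total recursive enumeration g n i (i >= 1) of the n-ary elements
       (g n i = 0: fewer than i n-ary elements; g n i = (code a).+1: the
       i-th n-ary element is a), and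
   (2) a partial recursive function computing the product of any
       representation of any element of H A. *)
Definition Halg_computable (A : Type) (ar : A -> nat) (pi : hgraph A -> A) : Prop :=
  exists code : A -> nat, injective code /\
  (exists g : nat -> nat -> nat,
     (exists c : recf 2, forall n i, 0 < i -> eval c [:: n; i] (g n i)) /\
     (forall n i, 0 < i -> g n i.+1 <> 0 -> g n i <> 0) /\
     (forall n i, 0 < i -> g n i <> 0 -> exists a, ar a = n /\ g n i = (code a).+1) /\
     (forall a, exists i, 0 < i /\ g (ar a) i = (code a).+1) /\
     (forall n i j, 0 < i -> 0 < j -> g n i <> 0 -> g n i = g n j -> i = j)) /\
  (exists c : recf 1, forall G n, hwf ar G -> represents code G n ->
       eval c [:: n] (code (pi G))).

(* Counting MSO over the MSO_2 model of a hypergraph (arity 0: no constants). *)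

Inductive cmso (S : Type) : Type :=
| FIn (x X : nat)
| FEq (x y : nat)
| FLab (a : S) (x : nat)
| FInc (i : nat) (x y : nat)
| FMod (X k m : nat)
| FNot (p : cmso S)
| FAnd (p q : cmso S)
| FEx1 (x : nat) (p : cmso S)
| FEx2 (X : nat) (p : cmso S).

Definition upd (T : Type) (r : nat -> T) (x : nat) (t : T) : nat -> T :=
  fun y => if y == x then t else r y.

Fixpoint sat (S : Type) (G : hgraph S)
    (r1 : nat -> option (hV G + hE G)%type) (r2 : nat -> {set (hV G + hE G)%type})
    (p : cmso S) : Prop :=
  match p with
  | FIn x X => if r1 x is Some u then u \in r2 X else False
  | FEq x y => if r1 x is Some u then r1 y = Some u else False
  | FLab a x => if r1 x is Some (inr e) then hlab G e = a else False
  | FInc i x y =>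
      match r1 x, r1 y with
      | Some (inr e), Some (inl v) =>
          0 < i /\ nth None (map Some (hinc G e)) i.-1 = Some v
      | _, _ => False
      end
  | FMod X k m => #|r2 X| = k %[mod m]
  | FNot q => ~ sat r1 r2 q
  | FAnd q s => sat r1 r2 q /\ sat r1 r2 s
  | FEx1 x q => exists u, sat (upd r1 x (Some u)) r2 q
  | FEx2 X q => exists U, sat r1 (upd r2 X U) q
  end.

Definition models (S : Type) (G : hgraph S) (p : cmso S) : Prop :=
  @sat S G (fun _ => None) (fun _ => set0) p.

Definition cmso2_definable (S : Type) (arS : S -> nat) (L : hgraph S -> Prop) : Prop :=
  exists p : cmso S, forall G, hwf arS G -> harity G = 0 -> (L G <-> models G p).

(* Main.v *)
From HB Require Import structures.
Require Import Defs.
From mathcomp Require Import all_boot.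
From mathcomp Require Import zify.
From mathcomp Require Import boolp.
Set Implicit Arguments. Unset Strict Implicit. Unset Printing Implicit Defensive.

(** Attaching a marker hyperedge to every vertex that is not a source turns sets
    of vertices into sets of hyperedges, so quantification over sets only
    recolours hyperedges. The hyperedges of a flattening are the pairs [(e, f)],
    hence the choices of a label for each of them are independent and the
    subsets of an H-algebra form again an H-algebra, which recognises the
    projections of recognised languages. Starting from an algebra that counts
    letters and vertex types up to a threshold and a modulus, which decides the
    atomic formulas, as many powersets as the quantifier depth give an algebra
    whose values determine the truth of the sentence, by an
    Ehrenfeucht-Fraisse argument. All subsets are kept, including those that are
    values of no hypergraph: the set of values that do occur need not be
    computable. Each algebra of the tower is finite on every arity, and both the
    list of its elements and its product are primitive recursive in those of the
    previous one. *)

(** * Recursive functions *)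

(** A source of a label is glued to a vertex outside, so a set of vertices of a flattening does not
    split into independent choices; this is the obstacle that the markers remove. A vertex gets its
    marker where it stops being a source, hence exactly once, and marking commutes with flattening
    up to isomorphism. Marking is therefore a change of the product, made once around the whole
    tower, and the powersets below it choose for hyperedges only. Incidence still has to be read
    off. The base algebra keeps, for each source, how many hyperedges of each letter meet it at each
    position, and turns this into a count of vertex types when the vertex ceases to be a source. The
    marker is among these hyperedges, so the type of a vertex also shows its colours. A first-order
    variable is a colour with a single bearer, so the threshold must be at least 2, to tell one from
    none and from many. It also exceeds every [k] of a counting predicate, since for modulus 0
    congruence is equality. The modulus is the product of the positive moduli in the sentence. Each
    nested quantifier takes one fresh colour, so there are finitely many letters. *)

Definition rc (f : nat -> nat) : Prop :=
  exists c : recf 1, forall x, eval c [:: x] (f x).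

Definition rc2 (f : nat -> nat -> nat) : Prop :=
  exists c : recf 2, forall x y, eval c [:: x; y] (f x y).

Lemma eval_proj k (i : 'I_k) xs y :
  size xs = k -> nth 0 xs i = y -> eval (rProj i) xs y.
Proof. by move=> sz <-; apply: ev_proj. Qed.

Lemma eval_comp1 k (f : recf 1) (g : recf k) xs a y :
  eval g xs a -> eval f [:: a] y ->
  eval (rComp f (Defs.rcons g (rnil k))) xs y.
Proof.
by move=> ga fy; apply: ev_comp fy; apply: evs_cons ga (evs_nil _ _).
Qed.

Lemma eval_comp2 k (f : recf 2) (g1 g2 : recf k) xs a b y :
  eval g1 xs a -> eval g2 xs b -> eval f [:: a; b] y ->
  eval (rComp f (Defs.rcons g1 (Defs.rcons g2 (rnil k)))) xs y.
Proof.
move=> ga gb fy; apply: ev_comp fy.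
by apply: evs_cons ga _; apply: evs_cons gb (evs_nil _ _).
Qed.

Lemma rc_ext f g : f =1 g -> rc f -> rc g.
Proof. by move=> fg [c Hc]; exists c => x; rewrite -fg. Qed.

Lemma rc_id : rc id.
Proof. by exists (rProj (ord0 : 'I_1)) => x; apply: eval_proj. Qed.

Lemma rc_comp f g : rc f -> rc g -> rc (fun x => f (g x)).
Proof.
move=> [c Hc] [d Hd]; exists (rComp c (Defs.rcons d (rnil 1))) => x.
exact: eval_comp1 (Hd x) (Hc _).
Qed.

Lemma rc_comp2 f g h : rc2 f -> rc g -> rc h -> rc (fun x => f (g x) (h x)).
Proof.
move=> [c Hc] [d Hd] [e He].
exists (rComp c (Defs.rcons d (Defs.rcons e (rnil 1)))) => x.
exact: eval_comp2 (Hd x) (He x) (Hc _ _).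
Qed.

Lemma rc_succ : rc succn.
Proof. by exists rSucc => x; apply: ev_succ. Qed.

Lemma rc_const n : rc (fun=> n).
Proof.
elim: n => [|n IH]; first by exists (rZero 1) => x; apply: ev_zero.
exact: rc_comp rc_succ IH.
Qed.

Lemma rc_rec0 (g : nat -> nat -> nat) (h : nat -> nat) :
  rc2 g -> h 0 = 0 -> (forall n, h n.+1 = g n (h n)) -> rc h.
Proof.
move=> [c Hc] h0 hS; exists (rPrec (rZero 0) c); elim=> [|n IH].
  by rewrite h0; apply: ev_prec0; apply: ev_zero.
by rewrite hS; apply: ev_precS IH (Hc _ _).
Qed.

Lemma rc2_iter f : rc f -> rc2 (fun n x => iter n f x).
Proof.
move=> [c Hc].
exists (rPrec (rProj (ord0 : 'I_1))
  (rComp c (Defs.rcons (rProj (inord 1 : 'I_3)) (rnil 3)))) => n x.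
elim: n => [|n IH].
  by apply: ev_prec0; apply: eval_proj.
apply: ev_precS IH _; apply: eval_comp1 (Hc _).
by apply: eval_proj => //; rewrite inordK.
Qed.

Lemma rc2_swap f : rc2 f -> rc2 (fun x y => f y x).
Proof.
move=> [c Hc]; exists (rComp c (Defs.rcons (rProj (inord 1 : 'I_2))
  (Defs.rcons (rProj (ord0 : 'I_2)) (rnil 2)))) => x y.
by apply: eval_comp2 (Hc _ _); apply: eval_proj; rewrite ?inordK.
Qed.

Lemma rc2_comp f g h : rc2 f -> rc2 g -> rc2 h ->
  rc2 (fun x y => f (g x y) (h x y)).
Proof.
move=> [c Hc] [d Hd] [e He].
exists (rComp c (Defs.rcons d (Defs.rcons e (rnil 2)))) => x y.
exact: eval_comp2 (Hd _ _) (He _ _) (Hc _ _).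
Qed.

Lemma rc2_1 f g : rc f -> rc2 g -> rc2 (fun x y => f (g x y)).
Proof.
move=> [c Hc] [d Hd]; exists (rComp c (Defs.rcons d (rnil 2))) => x y.
exact: eval_comp1 (Hd _ _) (Hc _).
Qed.

Lemma rc2_left : rc2 (fun x _ => x).
Proof. by exists (rProj (ord0 : 'I_2)) => x y; apply: eval_proj. Qed.

Lemma rc2_right : rc2 (fun _ y => y).
Proof. exact: rc2_swap rc2_left. Qed.

Lemma rc2_ext f g : f =2 g -> rc2 f -> rc2 g.
Proof. by move=> fg [c Hc]; exists c => x y; rewrite -fg. Qed.

Lemma rc2_add : rc2 addn.
Proof. by apply: rc2_ext (rc2_iter rc_succ) => x y; rewrite iter_succn addnC. Qed.

Lemma rc_pred : rc predn.
Proof. by apply: (rc_rec0 rc2_left). Qed.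

Lemma rc2_sub : rc2 subn.
Proof.
apply: rc2_ext (rc2_swap (rc2_iter rc_pred)) => x y.
elim: y => [|y IH] /=; first by rewrite subn0.
by rewrite IH subnS.
Qed.

Definition triangular (s : nat) : nat := s * s.+1 %/ 2.

Lemma triangularS s : triangular s.+1 = triangular s + s.+1.
Proof. by rewrite /triangular; nia. Qed.

Lemma cpairE x y : cpair x y = triangular (x + y) + y.
Proof. by []. Qed.

Lemma rc_triangular : rc triangular.
Proof.
apply: (rc_rec0 (g := fun n t => t + n.+1)) => [||n]; last exact: triangularS.
  apply: rc2_comp rc2_add rc2_right _; exact: rc2_1 rc_succ rc2_left.
by [].
Qed.

(* The index of the antidiagonal of [n] in Cantor's enumeration. *)
Fixpoint diag (n : nat) : nat :=
  if n is m.+1 then diag m + (1 - (triangular (diag m).+1 - m.+1)) else 0.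

Lemma rc_diag : rc diag.
Proof.
apply: (rc_rec0 (g := fun m s => s + (1 - (triangular s.+1 - m.+1)))) => //.
apply: rc2_comp rc2_add rc2_right _.
apply: rc2_comp rc2_sub (rc2_1 (rc_const 1) rc2_left) _.
apply: rc2_comp rc2_sub _ (rc2_1 rc_succ rc2_left).
exact: rc2_1 rc_triangular (rc2_1 rc_succ rc2_right).
Qed.

(** The truncated difference [1 - (triangular _ - m.+1)] is 1 exactly when [m.+1] has reached the
    next triangular number, so the index moves up exactly where an antidiagonal begins. *)
Lemma diagP n : triangular (diag n) <= n < triangular (diag n).+1.
Proof.
elim: n => [|n /andP[le lt]] //=.
case: (leqP (triangular (diag n).+1) n.+1) => h.
  have -> : diag n + (1 - (triangular (diag n).+1 - n.+1)) = (diag n).+1 by lia.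
  by rewrite h (triangularS (diag n).+1); lia.
have -> : diag n + (1 - (triangular (diag n).+1 - n.+1)) = diag n by lia.
by rewrite h leqW.
Qed.

Lemma leq_triangular s t : s <= t -> triangular s <= triangular t.
Proof.
move=> /subnKC <-; elim: (t - s) => [|n IH]; first by rewrite addn0.
by rewrite addnS triangularS (leq_trans IH) ?leq_addr.
Qed.

Lemma diag_cpair x y : diag (cpair x y) = x + y.
Proof.
have /andP[le lt] := diagP (cpair x y).
rewrite cpairE in le lt *.
have := triangularS (x + y).
case: (ltngtP (diag (triangular (x + y) + y)) (x + y)) => // h.
  by have := leq_triangular h; lia.
by have := leq_triangular h; lia.
Qed.

Definition usnd (n : nat) : nat := n - triangular (diag n).
Definition ufst (n : nat) : nat := diag n - usnd n.

Lemma usnd_cpair x y : usnd (cpair x y) = y.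
Proof. by rewrite /usnd diag_cpair cpairE; lia. Qed.

Lemma ufst_cpair x y : ufst (cpair x y) = x.
Proof. by rewrite /ufst usnd_cpair diag_cpair addnK. Qed.

Lemma rc_usnd : rc usnd.
Proof. exact: rc_comp2 rc2_sub rc_id (rc_comp rc_triangular rc_diag). Qed.

Lemma rc_ufst : rc ufst.
Proof. exact: rc_comp2 rc2_sub rc_diag rc_usnd. Qed.

Lemma rc2_cpair : rc2 cpair.
Proof.
by apply: rc2_comp rc2_add (rc2_1 rc_triangular rc2_add) rc2_right.
Qed.

Lemma cpair_inj x y x' y' : cpair x y = cpair x' y' -> x = x' /\ y = y'.
Proof. by move=> e; rewrite -(ufst_cpair x y) e ufst_cpair -(usnd_cpair x y) e usnd_cpair. Qed.

Lemma leq_cpairr x y : y <= cpair x y.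
Proof. by rewrite cpairE leq_addl. Qed.

Lemma rc_cpair f g : rc f -> rc g -> rc (fun x => cpair (f x) (g x)).
Proof. exact: rc_comp2 rc2_cpair. Qed.

(** The iterated function depends on the parameter [z]; the loop carries [z] along in a pair, which
    reduces this to iteration without parameters. *)
Lemma rc_iter F n a : rc F -> rc n -> rc a ->
  rc (fun z => iter (n z) (fun y => F (cpair z y)) (a z)).
Proof.
move=> rF rn ra.
pose st p := cpair (ufst p) (F p).
have rst : rc st by apply: rc_cpair rc_ufst rF.
apply: rc_ext (rc_comp rc_usnd
  (rc_comp2 (rc2_iter rst) rn (rc_cpair rc_id ra))) => z /=.
suff -> : iter (n z) st (cpair z (a z)) =
   cpair z (iter (n z) (fun y => F (cpair z y)) (a z)) by rewrite usnd_cpair.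
by elim: (n z) => //= m ->; rewrite /st ufst_cpair.
Qed.

(** A case distinction is a loop of length [b z] that starts at [f z] and whose body ignores its
    state and returns [g z]. *)
Lemma rc_ifz b f g : rc b -> rc f -> rc g ->
  rc (fun z => if b z == 0 then f z else g z).
Proof.
move=> rb rf rg.
apply: rc_ext (rc_iter (F := fun p => g (ufst p)) (rc_comp rg rc_ufst) rb rf) => z.
by case: (b z) => //= m; rewrite ufst_cpair.
Qed.

(** * Computable functions between encoded types *)

Class Enc (T : Type) := enc : T -> nat.

#[global] Instance enc_nat : Enc nat := id.
#[global] Instance enc_bool : Enc bool := nat_of_bool.
#[global] Instance enc_prod X Y (eX : Enc X) (eY : Enc Y) : Enc (X * Y) :=
  fun p => cpair (enc p.1) (enc p.2).
#[global] Instance enc_seq X (eX : Enc X) : Enc (seq X) :=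
  fun s => enc_list (map enc s).

(** Only the values of [g] on codes matter, so functions are composed on codes directly and codes
    never have to be recognised or decoded. *)
Definition computable X Y (eX : Enc X) (eY : Enc Y) (f : X -> Y) : Prop :=
  exists2 g, rc g & forall x, g (enc x) = enc (f x).
Arguments computable {X Y eX eY} f.

Lemma enc_prod_inj X Y (eX : Enc X) (eY : Enc Y) :
  injective eX -> injective eY -> injective (enc_prod eX eY).
Proof.
move=> iX iY [a b] [c d] /cpair_inj[/= ea eb].
by congr (_, _); [apply: iX | apply: iY].
Qed.

Lemma enc_seq_inj X (eX : Enc X) : injective eX -> injective (enc_seq eX).
Proof.
move=> iX; elim=> [|a s IH] [|b t] // [] /cpair_inj[/iX-> e].
by congr cons; apply: IH.
Qed.

Section Closure.
Context {X Y Z T : Type} {eX : Enc X} {eY : Enc Y} {eZ : Enc Z} {eT : Enc T}.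

Lemma cmp_ext (f g : X -> Y) : f =1 g -> computable f -> computable g.
Proof. by move=> fg [h rh Hh]; exists h => // x; rewrite Hh fg. Qed.

Lemma cmp_id : computable (fun x : X => x).
Proof. by exists id => //; apply: rc_id. Qed.

Lemma cmp_const (y : Y) : computable (fun _ : X => y).
Proof. by exists (fun=> enc y) => //; apply: rc_const. Qed.

Lemma cmp_comp (f : Y -> Z) (g : X -> Y) :
  computable f -> computable g -> computable (fun x => f (g x)).
Proof.
move=> [f' rf Hf] [g' rg Hg]; exists (fun x => f' (g' x)); first exact: rc_comp.
by move=> x; rewrite Hg Hf.
Qed.

Lemma cmp_pair (f : X -> Y) (g : X -> Z) :
  computable f -> computable g -> computable (fun x => (f x, g x)).
Proof.
move=> [f' rf Hf] [g' rg Hg].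
exists (fun x => cpair (f' x) (g' x)); first exact: rc_cpair.
by move=> x; rewrite Hf Hg.
Qed.

Lemma cmp_fst (f : X -> Y * Z) : computable f -> computable (fun x => (f x).1).
Proof.
move=> [f' rf Hf]; exists (fun x => ufst (f' x)); first exact: rc_comp rc_ufst rf.
by move=> x; rewrite Hf ufst_cpair.
Qed.

Lemma cmp_snd (f : X -> Y * Z) : computable f -> computable (fun x => (f x).2).
Proof.
move=> [f' rf Hf]; exists (fun x => usnd (f' x)); first exact: rc_comp rc_usnd rf.
by move=> x; rewrite Hf usnd_cpair.
Qed.

Lemma cmp_enc (f : X -> Y) : computable f -> computable (fun x => enc (f x) : nat).
Proof. by move=> [g rg Hg]; exists g. Qed.

Lemma cmp_succ (f : X -> nat) : computable f -> computable (fun x => (f x).+1).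
Proof.
move=> [f' rf Hf]; exists (fun x => (f' x).+1); first exact: rc_comp rc_succ rf.
by move=> x; rewrite Hf.
Qed.

Lemma cmp_pred (f : X -> nat) : computable f -> computable (fun x => (f x).-1).
Proof.
move=> [f' rf Hf]; exists (fun x => (f' x).-1); first exact: rc_comp rc_pred rf.
by move=> x; rewrite Hf.
Qed.

Lemma cmp_if (b : X -> bool) (f g : X -> Y) :
  computable b -> computable f -> computable g ->
  computable (fun x => if b x then f x else g x).
Proof.
move=> [b' rb Hb] [f' rf Hf] [g' rg Hg].
exists (fun x => if b' x == 0 then g' x else f' x); first exact: rc_ifz.
by move=> x; rewrite Hb Hf Hg; case: (b x).
Qed.

Lemma cmp_eq0 (f : X -> nat) : computable f -> computable (fun x => f x == 0).
Proof.
move=> [f' rf Hf]; exists (fun x => if f' x == 0 then 1 else 0).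
  by apply: rc_ifz => //; apply: rc_const.
by move=> x; rewrite Hf; case: (f x).
Qed.

Lemma cmp_iter (F : X -> Y -> Y) (n : X -> nat) (a : X -> Y) :
  computable (fun p : X * Y => F p.1 p.2) -> computable n -> computable a ->
  computable (fun x => iter (n x) (F x) (a x)).
Proof.
move=> [F' rF HF] [n' rn Hn] [a' ra Ha].
exists (fun z => iter (n' z) (fun y => F' (cpair z y)) (a' z)).
  exact: rc_iter.
move=> x; rewrite Hn Ha /enc /enc_nat /=.
elim: (n x) => //= m ->; exact: (HF (x, _)).
Qed.

Lemma cmp_add (f g : X -> nat) :
  computable f -> computable g -> computable (fun x => f x + g x).
Proof.
move=> [f' rf Hf] [g' rg Hg]; exists (fun x => f' x + g' x).
  exact: rc_comp2 rc2_add rf rg.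
by move=> x; rewrite Hf Hg.
Qed.

Lemma cmp_sub (f g : X -> nat) :
  computable f -> computable g -> computable (fun x => f x - g x).
Proof.
move=> [f' rf Hf] [g' rg Hg]; exists (fun x => f' x - g' x).
  exact: rc_comp2 rc2_sub rf rg.
by move=> x; rewrite Hf Hg.
Qed.

Lemma cmp_cons (f : X -> Y) (g : X -> seq Y) :
  computable f -> computable g -> computable (fun x => f x :: g x).
Proof.
move=> [f' rf Hf] [g' rg Hg]; exists (fun x => (cpair (f' x) (g' x)).+1).
  exact: rc_comp rc_succ (rc_cpair rf rg).
by move=> x; rewrite Hf Hg.
Qed.

(** The code of a non-empty list is the successor of the code of the pair of head and tail, so
    testing for 0 and taking a predecessor is a pattern match. *)
Lemma cmp_caseseq (l : X -> seq T) (g : X -> Y) (F : X -> T -> seq T -> Y) :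
  computable (fun p : X * (T * seq T) => F p.1 p.2.1 p.2.2) ->
  computable l -> computable g ->
  computable (fun x => if l x is t :: s then F x t s else g x).
Proof.
move=> [F' rF HF] [l' rl Hl] [g' rg Hg].
exists (fun z => if l' z == 0 then g' z else F' (cpair z (l' z).-1)).
  by apply: rc_ifz => //; apply: rc_comp rF (rc_cpair rc_id (rc_comp rc_pred rl)).
move=> x; rewrite Hl; case: (l x) => [|t s] //=; exact: (HF (x, (t, s))).
Qed.
End Closure.

Lemma cmp_comp2 X Y Z W (eX : Enc X) (eY : Enc Y) (eZ : Enc Z) (eW : Enc W)
    (f : Y -> Z -> W) (a : X -> Y) (b : X -> Z) :
  computable (fun p : Y * Z => f p.1 p.2) -> computable a -> computable b ->
  computable (fun x => f (a x) (b x)).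
Proof.
move=> cf ca cb; exact: (cmp_comp (f := fun p : Y * Z => f p.1 p.2) cf (cmp_pair ca cb)).
Qed.

Lemma cmp_comp3 X Y Z U W (eX : Enc X) (eY : Enc Y) (eZ : Enc Z) (eU : Enc U)
    (eW : Enc W) (f : Y -> Z -> U -> W) (a : X -> Y) (b : X -> Z) (c : X -> U) :
  computable (fun p : Y * (Z * U) => f p.1 p.2.1 p.2.2) ->
  computable a -> computable b -> computable c ->
  computable (fun x => f (a x) (b x) (c x)).
Proof.
move=> cf ca cb cc.
exact: (cmp_comp (f := fun p : Y * (Z * U) => f p.1 p.2.1 p.2.2) cf
  (cmp_pair ca (cmp_pair cb cc))).
Qed.

Ltac cmp_step := cbv beta; lazymatch goal with
  | |- computable (fun _ => ?c) => apply: cmp_const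
  | |- computable (fun x => x) => apply: cmp_id
  | |- computable fst => exact: (cmp_fst cmp_id)
  | |- computable snd => exact: (cmp_snd cmp_id)
  | |- computable (fun x => (_, _)) => apply: cmp_pair
  | |- computable (fun x => fst _) => apply: cmp_fst
  | |- computable (fun x => snd _) => apply: cmp_snd
  | |- computable (fun x => S _) => apply: cmp_succ
  | |- computable (fun x => predn _) => apply: cmp_pred
  | |- computable (fun x => addn _ _) => apply: cmp_add
  | |- computable (fun x => subn _ _) => apply: cmp_sub
  | |- computable (fun x => cons _ _) => apply: cmp_cons
  | |- computable (fun x => enc _) => apply: cmp_enc
  | |- computable (fun x => if _ then _ else _) => apply: cmp_if
  end.
Ltac cmp := repeat cmp_step.

(** * Computability of operations on lists *)

Section Lists.
Context {X Y T : Type} {eX : Enc X} {eY : Enc Y} {eT : Enc T}.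

Lemma size_le_enc (s : seq T) : size s <= enc s.
Proof. by elim: s => //= a s IH; rewrite ltnS (leq_trans IH) // leq_cpairr. Qed.

(** The loop runs [enc (l x)] times: the code bounds the length and is available before [size] is
    known to be computable. Surplus steps leave a state with empty list unchanged. *)
Lemma cmp_foldl (F : X -> Y -> T -> Y) (a : X -> Y) (l : X -> seq T) :
  computable (fun p : X * (Y * T) => F p.1 p.2.1 p.2.2) ->
  computable a -> computable l ->
  computable (fun x => foldl (F x) (a x) (l x)).
Proof.
move=> cF ca cl.
pose st x (p : seq T * Y) := if p.1 is t :: s then (s, F x p.2 t) else p.
have cst : computable (fun q : X * (seq T * Y) => st q.1 q.2).
  apply: (cmp_caseseq (F := fun (q : X * (seq T * Y)) t s => (s, F q.1 q.2.2 t))); try by cmp.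
  by cmp; apply: (cmp_comp3 (f := F) cF); cmp.
have := cmp_snd (cmp_iter cst (cmp_enc cl) (cmp_pair cl ca)).
apply: cmp_ext => x /=.
have : size (l x) <= enc (l x) := size_le_enc _.
move: (enc (l x)) => n; elim: n (l x) (a x) => [|n IH] [|t s] y //= le.
  by rewrite (_ : iter n (st x) ([::], y) = ([::], y)) //; elim: (n) => //= k ->.
by rewrite -iterS iterSr IH.
Qed.

End Lists.

Lemma cmp_rev X T (eX : Enc X) (eT : Enc T) (l : X -> seq T) : computable l -> computable (fun x => rev (l x)).
Proof.
move=> cl.
have c0 : computable (fun x : X => ([::] : seq T)) by cmp.
have cF : computable (fun p : X * (seq T * T) => p.2.2 :: p.2.1) by cmp.
have := cmp_foldl (F := fun _ y t => t :: y) cF c0 cl.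
apply: cmp_ext => x; rewrite /rev; move: [::]; by elim: (l x) => //= t s IH y.
Qed.

Lemma cmp_foldr X Y T (eX : Enc X) (eY : Enc Y) (eT : Enc T)
    (F : X -> T -> Y -> Y) (a : X -> Y) (l : X -> seq T) :
  computable (fun p : X * (T * Y) => F p.1 p.2.1 p.2.2) ->
  computable a -> computable l ->
  computable (fun x => foldr (F x) (a x) (l x)).
Proof.
move=> cF ca cl.
have cF' : computable (fun p : X * (Y * T) => F p.1 p.2.2 p.2.1).
  by apply: (cmp_comp (f := fun p : X * (T * Y) => F p.1 p.2.1 p.2.2)
    (g := fun p => (p.1, (p.2.2, p.2.1))) cF); cmp.
have := cmp_foldl (F := fun x y t => F x t y) cF' ca (cmp_rev cl).
by apply: cmp_ext => x; rewrite foldl_rev.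
Qed.

Section Lists2.
Context {X T U : Type} {eX : Enc X} {eT : Enc T} {eU : Enc U}.

Lemma cmp_map (F : X -> T -> U) (l : X -> seq T) :
  computable (fun p : X * T => F p.1 p.2) -> computable l ->
  computable (fun x => map (F x) (l x)).
Proof.
move=> cF cl.
apply: (cmp_ext (f := fun x => foldr (fun t s => F x t :: s) [::] (l x))).
  by move=> x; elim: (l x) => //= t s ->.
apply: cmp_foldr => //; cmp.
by apply: (cmp_comp2 (f := F) cF); cmp.
Qed.

Lemma cmp_filter (F : X -> T -> bool) (l : X -> seq T) :
  computable (fun p : X * T => F p.1 p.2) -> computable l ->
  computable (fun x => filter (F x) (l x)).
Proof.
move=> cF cl.
apply: (cmp_ext (f := fun x => foldr (fun t s => if F x t then t :: s else s) [::] (l x))).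
  by move=> x; elim: (l x) => //= t s ->.
apply: cmp_foldr => //; cmp.
by apply: (cmp_comp2 (f := F) cF); cmp.
Qed.

Lemma cmp_has (F : X -> T -> bool) (l : X -> seq T) :
  computable (fun p : X * T => F p.1 p.2) -> computable l ->
  computable (fun x => has (F x) (l x)).
Proof.
move=> cF cl.
apply: (cmp_ext (f := fun x => foldr (fun t s => if F x t then true else s) false (l x))).
  by move=> x; elim: (l x) => //= t s ->.
apply: cmp_foldr => //; cmp.
by apply: (cmp_comp2 (f := F) cF); cmp.
Qed.

Lemma cmp_cat (l m : X -> seq T) :
  computable l -> computable m -> computable (fun x => l x ++ m x).
Proof.
move=> cl cm.
apply: (cmp_ext (f := fun x => foldr (fun t s => t :: s) (m x) (l x))).
  by move=> x; elim: (l x) => //= t s ->.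
by apply: (cmp_foldr (F := fun _ t s => t :: s)) => //; cmp.
Qed.

Lemma cmp_size (l : X -> seq T) : computable l -> computable (fun x => size (l x)).
Proof.
move=> cl.
apply: (cmp_ext (f := fun x => foldr (fun _ n => n.+1) 0 (l x))).
  by move=> x; elim: (l x) => //= t s ->.
by apply: (cmp_foldr (F := fun _ _ n => n.+1)) => //; cmp.
Qed.

Lemma cmp_nth (d : X -> T) (l : X -> seq T) (n : X -> nat) :
  computable d -> computable l -> computable n ->
  computable (fun x => nth (d x) (l x) (n x)).
Proof.
move=> cd cl cn.
apply: (cmp_ext (f := fun x => if iter (n x) behead (l x) is t :: _ then t else d x)).
  move=> x; elim: (n x) (l x) => [|m IH] [|t s] //=; rewrite -/(iter m.+1 _ _) iterSr.
    by rewrite IH nth_nil.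
  by rewrite IH.
apply: (cmp_caseseq (F := fun _ t _ => t)) => //; first by cmp.
apply: (cmp_iter (F := fun _ => behead)) => //.
apply: (cmp_ext (f := fun p : X * seq T => if p.2 is _ :: s then s else [::])).
  by move=> p; case: p.2.
by apply: (cmp_caseseq (F := fun _ _ s => s)); cmp.
Qed.
End Lists2.

Section Lists3.
Context {X T : Type} {eX : Enc X} {eT : Enc T}.

Lemma cmp_flatten (l : X -> seq (seq T)) :
  computable l -> computable (fun x => seq.flatten (l x)).
Proof.
move=> cl; apply: (cmp_foldr (F := fun _ (s t : seq T) => s ++ t)) => //; last by cmp.
by apply: cmp_cat; cmp.
Qed.

Lemma cmp_iota (n : X -> nat) : computable n -> computable (fun x => iota 0 (n x)).
Proof.
move=> cn.
apply: (cmp_ext (f := fun x => rev (iter (n x) (fun s => size s :: s) [::]))).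
  move=> x; set st := fun _ => _.
  have H m : size (iter m st [::]) = m by elim: m => //= m ->.
  elim: (n x) => // m; rewrite -(addn1 m) iotaD => <-.
  by rewrite add0n addn1 iterS {1}/st H rev_cons -cats1.
apply: cmp_rev; apply: (cmp_iter (F := fun _ s => size s :: s)) => //; cmp.
by apply: cmp_size; cmp.
Qed.

Lemma cmp_eqn (f g : X -> nat) :
  computable f -> computable g -> computable (fun x => f x == g x).
Proof.
move=> cf cg.
apply: (cmp_ext (f := fun x => (f x - g x) + (g x - f x) == 0)).
  by move=> x; rewrite addn_eq0 !subn_eq0 -eqn_leq.
by apply: cmp_eq0; cmp.
Qed.

Lemma cmp_neg (b : X -> bool) : computable b -> computable (fun x => ~~ b x).
Proof.
move=> cb; apply: (cmp_ext (f := fun x => if b x then false else true)).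
  by move=> x; case: (b x).
by cmp.
Qed.
End Lists3.

Lemma cmp_eq X (T : eqType) (eX : Enc X) (eT : Enc T) (f g : X -> T) :
  injective eT -> computable f -> computable g -> computable (fun x => f x == g x).
Proof.
move=> eT_inj cf cg; have := cmp_eqn (cmp_enc cf) (cmp_enc cg).
by apply: cmp_ext => x; rewrite (inj_eq eT_inj).
Qed.

Lemma cmp_mem X (T : eqType) (eX : Enc X) (eT : Enc T) (f : X -> T) (l : X -> seq T) :
  injective eT -> computable f -> computable l -> computable (fun x => f x \in l x).
Proof.
move=> eT_inj cf cl; apply: (cmp_ext (f := fun x => has (fun t => t == f x) (l x))).
  by move=> x; rewrite -has_pred1; apply: eq_has.
apply: cmp_has => //; apply: cmp_eq => //; cmp.
by apply: cmp_comp cf _; cmp.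
Qed.

Lemma cmp_index X (T : eqType) (eX : Enc X) (eT : Enc T) (f : X -> T) (l : X -> seq T) :
  injective eT -> computable f -> computable l -> computable (fun x => index (f x) (l x)).
Proof.
move=> eT_inj cf cl.
apply: (cmp_ext (f := fun x => foldr (fun t n => if t == f x then 0 else n.+1) 0 (l x))).
  by move=> x; elim: (l x) => //= t s ->.
apply: cmp_foldr => //; cmp; apply: cmp_eq => //; cmp.
by apply: cmp_comp cf _; cmp.
Qed.

Definition enc_fin (T : finType) : Enc T := fun x => enum_rank x.
Arguments enc_fin T _ : clear implicits.

Lemma enc_fin_inj (T : finType) : injective (enc_fin T).
Proof. by move=> x y /ord_inj/enum_rank_inj. Qed.

(** A function on a finite type is a lookup in a constant table; the empty type is separate because
    the lookup needs a default. *)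
Lemma cmp_fin (T : finType) Y (eY : Enc Y) (f : T -> Y) :
  computable (eX := enc_fin T) f.
Proof.
have [t0 _|T0] := pickP (fun _ : T => true); last first.
  by exists id => [|x]; [exact: rc_id | have := T0 x].
pose s := [seq f t | t <- enum T].
apply: (cmp_ext (f := fun t => nth (f t0) s (enc_fin T t))).
  move=> t; rewrite /s (nth_map t0) ?nth_enum_rank //.
  by rewrite -cardE; apply: ltn_ord.
by apply: cmp_nth; cmp; exact: (cmp_enc (@cmp_id T (enc_fin T))).
Qed.

(** * Algebras with computable structure *)

Local Notation rep A := (nat * (seq nat * seq (A * seq nat)))%type.

Definition rep_of (A : Type) (G : hgraph A) (fv : hV G -> nat) (es : seq (hE G)) : rep A :=
  (#|hV G|, (map fv (hsrc G), map (fun e => (hlab G e, map fv (hinc G e))) es)).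

Definition numbering (A : Type) (G : hgraph A) (fv : hV G -> nat) (es : seq (hE G)) : Prop :=
  [/\ injective fv, forall v, fv v < #|hV G|, uniq es & forall e, e \in es].

(** The invariant carried up the tower. It asks for the finite list of all [n]-ary elements as a
    computable function of [n], which is more than an enumeration: subsets can then be listed and
    filtered. The map [car_rpi] computes the product from any numbered presentation. *)
Record calg := CAlg {
  car :> eqType;
  car_ar : car -> nat;
  car_pi : hgraph car -> car;
  car_enc : Enc car;
  car_all : nat -> seq car;
  car_rpi : rep car -> car;
  car_alg : is_Halg car_ar car_pi;
  car_enc_inj : injective car_enc;
  car_all_uniq : forall n, uniq (car_all n);
  mem_car_all : forall n a, (a \in car_all n) = (car_ar a == n);
  cmp_car_all : computable car_all;
  cmp_car_rpi : computable car_rpi;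
  car_rpiP : forall (G : hgraph car) fv es, hwf car_ar G ->
    @numbering _ G fv es -> car_rpi (rep_of fv es) = car_pi G }.
#[global] Existing Instance car_enc.

Lemma calg_computable (B : calg) : Halg_computable (@car_ar B) (@car_pi B).
Proof.
exists (@car_enc B); split; first exact: car_enc_inj.
split.
  (* The enumeration counts from 1, hence [i.-1]; codes are shifted by one so that the default 0 can
     signal the end of the list. *)
  pose g n i := nth 0 (map (fun a : B => (@enc B (@car_enc B) a).+1) (car_all B n)) i.-1.
  have gE n i : g n i <> 0 -> i.-1 < size (car_all B n).
    by move=> h; rewrite ltnNge; apply/negP => le; apply: h; rewrite /g nth_default ?size_map.
  have x0 n i : i < size (car_all B n) -> {a : B | car_ar a = n & g n i.+1 = (enc a).+1}.
    move: (@mem_car_all B n); rewrite /g /=; case: (car_all B n) => [|a0 s] // sP lt.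
    exists (nth a0 (a0 :: s) i); last by rewrite (nth_map a0).
    by apply/eqP; rewrite -sP mem_nth.
  exists g; split; last split; last split; last split.
  - have [c rcc Hc] : computable (fun p : nat * nat => g p.1 p.2).
      apply: cmp_nth; cmp.
      apply: (cmp_map (F := fun _ (a : B) => (enc a).+1)); cmp.
      by apply: cmp_comp (cmp_car_all B) _; cmp.
    have [d Hd] : rc2 (fun x y => c (cpair x y)) by apply: rc2_1 rcc rc2_cpair.
    exists d => n i _.
    by have -> : g n i = c (cpair n i) by rewrite (Hc (n, i)).
  - by move=> n [|i] // _ /gE /= /ltnW lt; have [a _ ->] := x0 n i lt.
  - by move=> n [|i] // _ /gE /= /x0[a an ->]; exists a.
  - move=> a; exists (index a (car_all B (car_ar a))).+1; split=> //.
    have ain : a \in car_all B (car_ar a) by rewrite mem_car_all.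
    by rewrite /g /= (nth_map a) ?index_mem // nth_index.
  - move=> n [|i] [|j] // _ _ gi gij.
    have lti := gE _ _ gi; have gj : g n j.+1 <> 0 by rewrite -gij.
    have ltj := gE _ _ gj; move: gij; rewrite /g /=; move: lti ltj => /= lti ltj.
    have [a0 _ _] := x0 n i lti.
    rewrite !(nth_map a0) // => -[] /(@car_enc_inj B) /eqP.
    by rewrite nth_uniq ?car_all_uniq // => /eqP ->.
have [f [c Hc] Hf] := cmp_car_rpi B.
exists c => G n wfG [fv [es [fvI [fvlt [ues [ees ->]]]]]].
have <- : f (enc (rep_of fv es)) = car_enc (car_pi G).
  by rewrite Hf (@car_rpiP B G fv es).
have encs (s : seq nat) : enc s = enc_list s by rewrite /enc /enc_seq map_id.
have <- : enc (rep_of fv es) =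
  enc_hg #|hV G| [seq fv i | i <- hsrc G]
    [seq (car_enc (hlab G e), [seq fv i | i <- hinc G e]) | e <- es].
  rewrite /enc_hg -encs; congr (cpair _ (cpair _ _)).
  rewrite /enc /enc_seq -!map_comp.
  by congr enc_list; apply: eq_map => e /=; rewrite -encs.
exact: Hc.
Qed.

Lemma calg_finite (B : calg) : finite_on_every_arity (@car_ar B).
Proof.
move=> n; exists (size (car_all B n)), (tnth (in_tuple (car_all B n))) => a an.
have /tnthP[i ->] : a \in in_tuple (car_all B n) by rewrite mem_car_all an.
by exists i.
Qed.

Lemma calg_inhabited (B : calg) : B.
Proof. exact: (@car_pi B (@HG B void void (of_void B) (of_void _) [::])). Qed.

(** Relabelling by [a] commutes with flattening by computation, so the homomorphism law is the
    associativity law of the algebra for the relabelled hypergraph. *)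
Lemma hom_of_letters (S : Type) (arS : S -> nat) (A : Type) (ar : A -> nat)
    (pi : hgraph A -> A) (a : S -> A) :
  is_Halg ar pi -> (forall s, ar (a s) = arS s) ->
  is_hom_free arS ar pi (fun G => pi (hmap a G)).
Proof.
move=> [arP [isoP [unitP assocP]]] aP.
have wfa (G : hgraph S) : hwf arS G -> hwf ar (hmap a G).
  by move=> [uS uE]; split=> // e; rewrite /= aP; apply: uE.
split; last split.
- by move=> G /wfa/arP.
- move=> G H /wfa wG [fv [fe [bv [be [el [ei es]]]]]]; apply: isoP => //.
  by exists fv, fe; split=> //; split=> //; split=> [e|//] /=; rewrite el.
- move=> G [wG wl]; symmetry.
  apply: (assocP (hmap (hmap a) G)); split=> //= e; exact: wfa.
Qed.

(** * Powerset algebras *)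

Definition relab (A B : Type) (G : hgraph A) (s : hE G -> B) : hgraph B :=
  @HG B (hV G) (hE G) s (hinc G) (hsrc G).

Section Powerset.
Variable B : calg.
Local Notation ar := (@car_ar B).
Local Notation pi := (@car_pi B).
Local Notation elts := (car_all B).

(* An n-ary element is a subset of the n-ary elements of [B], listed in the
   order of [elts n] so that equality is extensional. *)
Definition pset : eqType := {p : nat * seq B | p.2 == [seq x <- elts p.1 | x \in p.2]}.

Definition pset_ar (a : pset) : nat := (val a).1.
Definition pset_elts (a : pset) : seq B := (val a).2.

Lemma mkpset_subproof n (P : pred B) :
  filter P (elts n) == [seq x <- elts n | x \in filter P (elts n)].
Proof.
by apply/eqP/eq_in_filter => x xn; rewrite mem_filter xn andbT.
Qed.

Definition mkpset n (P : pred B) : pset :=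
  exist _ (n, filter P (elts n)) (mkpset_subproof n P).

Lemma mem_mkpset n P x : (x \in pset_elts (mkpset n P)) = (ar x == n) && P x.
Proof. by rewrite mem_filter mem_car_all andbC. Qed.

Lemma pset_elts_ar a x : x \in pset_elts a -> ar x = pset_ar a.
Proof.
rewrite /pset_elts (eqP (valP a)) mem_filter mem_car_all => /andP[_ /eqP //].
Qed.

Lemma pset_ext a b :
  pset_ar a = pset_ar b -> pset_elts a =i pset_elts b -> a = b.
Proof.
move=> e ei; apply: val_inj; move: (valP a) (valP b).
rewrite [val a]surjective_pairing [val b]surjective_pairing => /= /eqP-> /eqP->.
rewrite -/(pset_ar a) e; congr pair; apply: eq_filter => x; exact: ei.
Qed.

Definition selects (G : hgraph pset) (s : hE G -> B) : Prop :=
  forall e, s e \in pset_elts (hlab G e).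

(** Membership is tested classically here; the algorithm is [pset_rpi], which lists all
    selections. *)
Definition pset_pi (G : hgraph pset) : pset :=
  mkpset (harity G) (fun x => `[< exists2 s, selects s & pi (@relab _ _ G s) = x >]).

Lemma hwf_relab (G : hgraph pset) (s : hE G -> B) :
  hwf pset_ar G -> selects s -> hwf ar (relab s).
Proof.
move=> [uS uE] ss; split=> // e /=.
by rewrite (pset_elts_ar (ss e)); apply: uE.
Qed.

Lemma mem_pset_pi (G : hgraph pset) x : hwf pset_ar G ->
  (x \in pset_elts (pset_pi G)) <-> (exists2 s, selects s & pi (@relab _ _ G s) = x).
Proof.
move=> wG; rewrite mem_mkpset; split=> [/andP[_ /asboolP //]|ex].
rewrite asboolT // andbT; have [s ss <-] := ex; apply/eqP.
have [arP _] := car_alg B; by rewrite arP //; apply: hwf_relab.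
Qed.

(** A selection for the flattening is the same thing as a family of selections, one for each label,
    and for such a family [E] is associativity in [B]. *)
Lemma pset_pi_assoc (G : hgraph (hgraph pset)) : hwf2 pset_ar G ->
  pset_pi (hmap pset_pi G) = pset_pi (Defs.flatten G).
Proof.
move=> [wG wl]; have [arP [_ [_ assocP]]] := car_alg B.
have wG' : hwf pset_ar (hmap pset_pi G) by split; [exact: wG.1 | exact: wG.2].
have wF2 (s : forall e : hE G, hE (inner e) -> B) :
    (forall e, selects (s e)) ->
    hwf2 ar (relab (fun e : hE G => relab (s e))).
  move=> ss; split=> [|e /=]; first by split; [exact: wG.1 | exact: wG.2].
  exact: hwf_relab (wl e) (ss e).
have E (s : forall e : hE G, hE (inner e) -> B) :
    (forall e, selects (s e)) ->
    pi (relab (G := hmap pset_pi G) (fun e => pi (relab (s e)))) =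
    pi (relab (G := Defs.flatten G) (fun x => s (tag x) (tagged x))).
  by move=> ss; apply: (assocP (relab (fun e : hE G => relab (s e)))); apply: wF2.
apply: pset_ext; first by rewrite /pset_ar /= /harity /= size_map.
move=> x; apply/idP/idP.
  move/(mem_pset_pi _ wG') => [s ss <-].
  (* Each chosen element of an inner product comes from some selection in that label; choosing one
     for every [e] gives a selection for the flattening. *)
  have ex (e : hE G) : exists t, selects t /\ pi (@relab _ _ (inner e) t) = s e.
    by have /(mem_pset_pi _ (wl e))[t tt te] := ss e; exists t.
  pose t e := sval (cid (ex e)).
  have tP e : selects (t e) /\ pi (relab (t e)) = s e := svalP (cid (ex e)).
  have -> : s = (fun e => pi (relab (t e))) by apply: funext => e; rewrite (tP e).2.
  rewrite E; last by move=> e; case: (tP e).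
  rewrite mem_mkpset; apply/andP; split.
    apply/eqP; rewrite -E; last by move=> e; case: (tP e).
    rewrite arP; first by rewrite /harity /= size_map.
    apply: hwf_relab => // e; rewrite (tP e).2; exact: ss.
  apply/asboolP; exists (fun x => t (tag x) (tagged x)) => // -[e f].
  exact: (tP e).1.
rewrite mem_mkpset => /andP[_ /asboolP[s ss <-]].
pose t e (f : hE (@inner _ G e)) := s (existT _ e f).
have tt e : selects (t e) by move=> f; apply: (ss (existT _ e f)).
have -> : s = (fun x => t (tag x) (tagged x)) by apply: funext => -[e f].
rewrite -E //; apply/(mem_pset_pi _ wG'); exists (fun e => pi (relab (t e))) => // e.
by apply/(mem_pset_pi _ (wl e)); exists (t e); [exact: tt|].
Qed.

Lemma pset_alg : is_Halg pset_ar pset_pi.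
Proof.
have [arP [isoP [unitP assocP]]] := car_alg B.
split; [by []|split; [|split]]; last exact: pset_pi_assoc.
- have half G H x : hwf pset_ar G -> hiso G H ->
      x \in pset_elts (pset_pi G) -> x \in pset_elts (pset_pi H).
    move=> wG iso.
    move/(mem_pset_pi _ wG) => [s ss <-]; move: iso.
    case=> fv [fe [bv [[fe' feK feK'] [el [ei es]]]]].
    rewrite mem_mkpset; apply/andP; split.
      rewrite arP; last exact: hwf_relab.
      by rewrite /harity /= es size_map.
    apply/asboolP; exists (fun e => s (fe' e)).
      by move=> e; rewrite -{2}(feK' e) el; apply: ss.
    symmetry; apply: isoP; first exact: hwf_relab.
    exists fv, fe; split=> //; split; first by exists fe'.
    by split=> // e /=; rewrite feK.
  move=> G H wG iso; apply: pset_ext.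
    by case: iso => fv [fe [_ [_ [_ [_ es]]]]]; rewrite /pset_ar /= /harity es size_map.
  move=> x; apply/idP/idP; first exact: half.
  case: iso => fv [fe [[fv' fvK fvK'] [[fe' feK feK'] [el [ei es]]]]].
  apply: half.
    case: wG => uS uE; split; first by rewrite es map_inj_uniq //; apply: can_inj fvK.
    move=> e; rewrite -(feK' e) ei el size_map map_inj_uniq //; exact: can_inj fvK.
  exists fv', fe'; split; first by exists fv.
  split; first by exists fe.
  split; first by move=> e; rewrite -{2}(feK' e) el.
  split; first by move=> e; rewrite -{2}(feK' e) ei -map_comp (eq_map fvK) map_id.
  by rewrite es -map_comp (eq_map fvK) map_id.
- move=> a.
  (* The unit of the set [a] has [pset_ar a] vertices, that of a member [x] has [ar x]; these agree
     only by a proved equation, so the unit law is restated for a variable [n]. *)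
  have key n x : ar x = n ->
      pi (@HG B 'I_n unit (fun=> x) (fun=> enum 'I_n) (enum 'I_n)) = x.
    by move=> <-; apply: unitP.
  apply: pset_ext; first by rewrite /pset_ar /= /harity /= size_enum_ord.
  move=> x; apply/idP/idP.
    rewrite mem_mkpset => /andP[_ /asboolP[s ss <-]].
    have -> : s = fun=> s tt by apply: funext => -[].
    by rewrite /relab /= key; [exact: (ss tt) | apply: pset_elts_ar (ss tt)].
  move=> xa; rewrite mem_mkpset /harity /= size_enum_ord (pset_elts_ar xa) eqxx /=.
  by apply/asboolP; exists (fun=> x) => //; apply: key; apply: pset_elts_ar.
Qed.

(** * Listing the subsets and computing their products *)

#[local] Instance pset_enc : Enc pset := fun a => enc (val a).

Lemma pset_enc_inj : injective pset_enc.
Proof.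
move=> a b /(enc_prod_inj (@inj_id nat) (enc_seq_inj (@car_enc_inj B))); exact: val_inj.
Qed.

Fixpoint subseqs (T : Type) (s : seq T) : seq (seq T) :=
  if s is x :: s' then subseqs s' ++ map (cons x) (subseqs s') else [:: [::]].

Lemma subseqs_uniq (T : eqType) (s : seq T) : uniq s -> uniq (subseqs s).
Proof.
elim: s => //= x s IH /andP[xs /IH us]; rewrite cat_uniq us.
rewrite map_inj_uniq ?us ?andbT => [|? ? []] //.
apply/hasPn => _ /mapP[t _ ->]; apply: contra xs.
have sub : forall u, u \in subseqs s -> {subset u <= s}.
  elim: (s) => [|y r IHr] u /=; first by rewrite inE => /eqP->.
  rewrite mem_cat => /orP[/IHr h z /h|/mapP[w /IHr h ->] z]; rewrite !inE.
    by move->; rewrite orbT.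
  by case/orP=> [->//|/h->]; rewrite orbT.
by move/sub; apply; rewrite inE eqxx.
Qed.

(** Sublists of a duplicate-free list are exactly the lists in the canonical form that [pset]
    demands, so [subseqs] yields every subset once. *)
Lemma mem_subseqs (T : eqType) (s u : seq T) : uniq s ->
  (u \in subseqs s) = (u == [seq x <- s | x \in u]).
Proof.
elim: s u => [|x s IH] u /=; first by rewrite inE.
move=> /andP[xs us]; rewrite mem_cat IH //; case: ifP => xu.
  have -> : u == [seq y <- s | y \in u] = false.
    apply/eqP => e; move: xu; rewrite e mem_filter (negbTE xs) andbF //.
  apply/mapP/eqP => [[w ws ->]|e].
    move: ws; rewrite IH // => /eqP {1}->; congr cons; apply: eq_in_filter => y ys.
    rewrite inE; case: eqP => [yx|//]; by rewrite yx (negbTE xs) in ys.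
  exists [seq y <- s | y \in u] => //; rewrite IH //; apply/eqP.
  by apply: eq_in_filter => y ys; rewrite mem_filter ys andbT.
rewrite orb_idr // => /mapP[w _ uw]; by rewrite uw inE eqxx in xu.
Qed.

Definition pset_all (n : nat) : seq pset :=
  [seq mkpset n (mem s) | s <- subseqs (elts n)].

Lemma val_pset_all n : [seq val a | a <- pset_all n] = [seq (n, s) | s <- subseqs (elts n)].
Proof.
rewrite /pset_all -map_comp; apply/eq_in_map => s.
by rewrite mem_subseqs ?car_all_uniq //= => /eqP {2}->.
Qed.

Lemma pset_all_uniq n : uniq (pset_all n).
Proof.
rewrite -(map_inj_uniq val_inj) val_pset_all map_inj_uniq ?subseqs_uniq ?car_all_uniq //.
by move=> ? ? [].
Qed.

Lemma mem_pset_all n a : (a \in pset_all n) = (pset_ar a == n).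
Proof.
rewrite -(mem_map val_inj) val_pset_all; apply/mapP/eqP => [[s _ e]|<-].
  by rewrite /pset_ar e.
exists (pset_elts a); last by rewrite -surjective_pairing.
by rewrite mem_subseqs ?car_all_uniq // (valP a).
Qed.

Lemma cmp_subseqs T (eT : Enc T) : computable (@subseqs T).
Proof.
apply: (cmp_ext (f := fun s => foldr (fun x u => u ++ map (cons x) u) [:: [::]] s)).
  by elim=> //= x s ->.
apply: (cmp_foldr (F := fun _ x u => u ++ map (cons x) u)); cmp.
apply: cmp_cat; cmp.
apply: (cmp_map (F := fun (p : seq T * (T * seq (seq T))) (t : seq T) => p.2.1 :: t)); cmp.
Qed.

Lemma cmp_pset_all : computable pset_all.
Proof.
have [g rg Hg] : computable (fun n => [seq (n, s) | s <- subseqs (elts n)]).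
  apply: (cmp_map (F := fun (n : nat) (s : seq B) => (n, s))); cmp.
  exact: cmp_comp (cmp_subseqs _) (cmp_car_all B).
exists g => // n; rewrite Hg -val_pset_all /enc /enc_seq -map_comp //.
Qed.

Fixpoint selections (es : seq (pset * seq nat)) : seq (seq (B * seq nat)) :=
  if es is e :: es' then
    seq.flatten [seq [seq (x, e.2) :: t | t <- selections es'] | x <- pset_elts e.1]
  else [:: [::]].

Definition pset_rpi (r : rep pset) : pset :=
  mkpset (size r.2.1)
    (fun x => x \in [seq car_rpi (r.1, (r.2.1, es)) | es <- selections r.2.2]).

Lemma cmp_pset_elts X (eX : Enc X) (f : X -> pset) :
  computable f -> computable (fun x => pset_elts (f x)).
Proof.
move=> [g rg Hg]; have : computable (fun x => val (f x)) by exists g.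
exact: cmp_snd.
Qed.

Lemma cmp_selections : computable selections.
Proof.
pose F (e : pset * seq nat) (u : seq (seq (B * seq nat))) :=
  seq.flatten [seq [seq (x, e.2) :: t | t <- u] | x <- pset_elts e.1].
apply: (cmp_ext (f := fun es => foldr F [:: [::]] es)).
  by elim=> //= x s ->.
apply: (cmp_foldr (F := fun _ => F)); cmp.
apply: cmp_flatten.
apply: (cmp_map (F := fun (p : seq (pset * seq nat) *
    ((pset * seq nat) * seq (seq (B * seq nat)))) (x : B) =>
  [seq (x, p.2.1.2) :: t | t <- p.2.2])); last by apply: cmp_pset_elts; cmp.
apply: (cmp_map (F := fun (q : (seq (pset * seq nat) *
    ((pset * seq nat) * seq (seq (B * seq nat)))) * B) t =>
  (q.2, q.1.2.1.2) :: t)); cmp.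
Qed.

Lemma cmp_pset_rpi : computable pset_rpi.
Proof.
have [g rg Hg] : computable (fun r : rep pset => val (pset_rpi r)); last by exists g.
rewrite /=; cmp; first by apply: cmp_size; cmp.
apply: cmp_filter; last first.
  by apply: cmp_comp (cmp_car_all B) _; apply: cmp_size; cmp.
apply: cmp_mem; [exact: car_enc_inj | by cmp |].
apply: (cmp_map (F := fun (p : rep pset * B) es => car_rpi (p.1.1, (p.1.2.1, es)))).
  by apply: cmp_comp (cmp_car_rpi B) _; cmp.
by apply: cmp_comp cmp_selections _; cmp.
Qed.

Lemma mem_selections (G : hgraph pset) fv (es : seq (hE G)) u : uniq es ->
  reflect (exists2 s : hE G -> B, forall e, e \in es -> s e \in pset_elts (hlab G e) &
            u = [seq (s e, map fv (hinc G e)) | e <- es])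
    (u \in selections [seq (hlab G e, map fv (hinc G e)) | e <- es]).
Proof.
elim: es u => [|e es IH] u /=.
  move=> _; rewrite inE; apply: (iffP eqP) => [->|[s _ ->//]].
  by exists (fun=> calg_inhabited B).
case/andP=> ees ues; have {}IH u' := IH u' ues.
apply: (iffP flatten_mapP) => [[x xe /mapP[t /IH[s ss ->] ->]]|[s ss ->]].
  (* Redefining the selection at [e] does not disturb the tail, because [es] has no repetitions. *)
  exists (fun f => if f == e then x else s f).
    by move=> f; rewrite inE; case: eqP => [->//|_]; apply: ss.
  rewrite eqxx; congr cons; apply/eq_in_map => f fes.
  by case: eqP => // fe; rewrite -fe fes in ees.
exists (s e); first by apply: ss; rewrite inE eqxx.
apply: map_f; apply/IH; exists s => // f fes; apply: ss.
by rewrite inE fes orbT.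
Qed.

Lemma pset_rpiP (G : hgraph pset) fv es : hwf pset_ar G ->
  @numbering _ G fv es -> pset_rpi (rep_of fv es) = pset_pi G.
Proof.
move=> wG [fvI fvlt ues ees]; apply: pset_ext; first by rewrite /pset_ar /= size_map.
have key s : selects s -> car_rpi (rep_of (G := relab s) fv es) = pi (@relab _ _ G s).
  by move=> ss; apply: car_rpiP => //; apply: hwf_relab.
move=> x; rewrite !mem_mkpset /= size_map; congr (_ && _).
apply/mapP/asboolP => [[u /(mem_selections fv _ ues)[s ss ->] ->]|[s ss <-]].
  by exists s; [move=> e; apply: ss | symmetry; apply: key => e; apply: ss].
exists [seq (s e, map fv (hinc G e)) | e <- es]; last by rewrite -key.
by apply/(mem_selections fv _ ues); exists s.
Qed.

Definition powerset_calg : calg :=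
  CAlg pset_alg pset_enc_inj pset_all_uniq mem_pset_all cmp_pset_all
    cmp_pset_rpi pset_rpiP.
End Powerset.

(** * Flattening *)

Section FlatVert.
Variables (A : Type) (ar : A -> nat) (G : hgraph (hgraph A)).
Hypothesis wG : hwf2 ar G.

Lemma flat_vert_nonsrc (e : hE G) (v : hV (inner e)) (h : v \notin hsrc (inner e)) :
  flat_vert v = Some (inr (existT _ e (exist _ v h))).
Proof. by rewrite /flat_vert insubT. Qed.

Lemma flat_vert_src (e : hE G) (v : hV (inner e)) : v \in hsrc (inner e) ->
  exists2 w, (w \in hinc G e) && (index w (hinc G e) == index v (hsrc (inner e))) &
    flat_vert v = Some (inl w).
Proof.
move=> vs; rewrite /flat_vert insubF ?vs //.
have [uS /(_ e)[ue se]] := wG.1.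
have lt : index v (hsrc (inner e)) < size (hinc G e) by rewrite se index_mem.
have [w0 _] : exists w, w \in hinc G e.
  by case: (hinc G e) lt => // w l _; exists w; rewrite inE eqxx.
exists (nth w0 (hinc G e) (index v (hsrc (inner e)))).
  by rewrite mem_nth // index_uniq // eqxx.
by rewrite (nth_map w0).
Qed.

Lemma flat_vert_some (e : hE G) (v : hV (inner e)) : exists y, flat_vert v = Some y.
Proof.
case: (boolP (v \in hsrc (inner e))) => [/flat_vert_src[w _ ->]|h]; first by exists (inl w).
by rewrite (flat_vert_nonsrc h); eexists.
Qed.

(** On well-formed input [flat_vert] never fails; this total version turns the [pmap] in the
    incidence of a flattening into a [map]. *)
Definition flat_pos (e : hE G) (v : hV (inner e)) : flatV G :=
  sval (cid (flat_vert_some v)).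

Lemma flat_posE (e : hE G) (v : hV (inner e)) : flat_vert v = Some (flat_pos v).
Proof. exact: svalP (cid (flat_vert_some v)). Qed.

Lemma flat_pos_nonsrc (e : hE G) (v : hV (inner e)) (h : v \notin hsrc (inner e)) :
  flat_pos v = inr (existT _ e (exist _ v h)).
Proof. by apply: Some_inj; rewrite -flat_posE; apply: flat_vert_nonsrc. Qed.

Lemma flat_pos_src (e : hE G) (v : hV (inner e)) : v \in hsrc (inner e) ->
  exists2 w, (w \in hinc G e) && (index w (hinc G e) == index v (hsrc (inner e))) &
    flat_pos v = inl w.
Proof.
by case/flat_vert_src=> w wP; rewrite flat_posE => -[E]; exists w.
Qed.

(** A source goes to the vertex at its own position in the incidence list of [e], so its image
    determines that position; a non-source goes to a vertex private to [e]. *)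
Lemma flat_pos_inj (e : hE G) : injective (@flat_pos e).
Proof.
move=> v v'.
case: (boolP (v \in hsrc (inner e))) => [vs|h];
  case: (boolP (v' \in hsrc (inner e))) => [vs'|h'].
- have [w /andP[_ /eqP wi] ->] := flat_pos_src vs.
  have [w' /andP[_ /eqP wi'] ->] := flat_pos_src vs'.
  move=> [E]; rewrite -(nth_index v vs) -(nth_index v vs').
  by rewrite -wi -wi' E.
- by have [w _ ->] := flat_pos_src vs; rewrite (flat_pos_nonsrc h').
- by have [w _ ->] := flat_pos_src vs'; rewrite (flat_pos_nonsrc h).
rewrite (flat_pos_nonsrc h) (flat_pos_nonsrc h') => -[] /eqP.
by rewrite eq_Tagged /= => /eqP [].
Qed.

Lemma flatten_inc (x : flatE G) :
  hinc (Defs.flatten G) x = map (@flat_pos (tag x)) (hinc (inner (tag x)) (tagged x)).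
Proof. by rewrite /=; elim: (hinc _ _) => //= v s IH; rewrite flat_posE /= IH. Qed.

Lemma hwf_flatten : hwf ar (Defs.flatten G).
Proof.
case: wG => -[uS _] wl; split; first by rewrite /= map_inj_uniq // => ? ? [].
move=> x; rewrite flatten_inc map_inj_uniq ?size_map; last exact: flat_pos_inj.
by have [_ /(_ (tagged x))] := wl (tag x).
Qed.
End FlatVert.

(** * Marking the vertices by unary hyperedges *)

Lemma inj_surj_bij (X Y : Type) (f : X -> Y) :
  injective f -> (forall y, exists x, f x = y) -> bijective f.
Proof.
move=> fI fS; pose g y := sval (cid (fS y)).
have gK y : f (g y) = y := svalP (cid (fS y)).
by exists g => [x|//]; apply: fI; rewrite gK.
Qed.

(** By counting, an injective numbering below [#|hV G|] is onto. Listing the vertices by number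
    turns loops over [iota] into operations over all vertices. *)
Lemma numbering_enum (A : Type) (G : hgraph A) fv es : @numbering _ G fv es ->
  exists2 l : seq (hV G), map fv l = iota 0 #|hV G| & perm_eq l (enum (hV G)).
Proof.
move=> [fvI fvlt _ _].
pose f v := Ordinal (fvlt v).
have fI : injective f by move=> x y [/fvI].
have [g fK gK] : bijective f by apply: inj_card_bij fI _; rewrite card_ord.
have lE : map fv (map g (enum 'I_#|hV G|)) = iota 0 #|hV G|.
  by rewrite -map_comp -val_enum_ord; apply: eq_map => i; rewrite /= -{2}(gK i).
exists (map g (enum 'I_#|hV G|)) => //; apply: uniq_perm.
- by rewrite -(map_inj_uniq fvI) lE iota_uniq.
- exact: enum_uniq.
by move=> v; rewrite mem_enum -(fK v) map_f ?mem_enum.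
Qed.

Section Mark.
Variables (A : Type) (u : A).

(** Sources stay unmarked: all vertices of a unit are sources, so the unit law survives, and a
    vertex shared by several labels is not marked in each of them. *)
Definition mark (G : hgraph A) : hgraph A :=
  @HG A (hV G) (hE G + {v : hV G | v \notin hsrc G})%type
    (fun x => match x with inl e => hlab G e | inr _ => u end)
    (fun x => match x with inl e => hinc G e | inr v => [:: val v] end)
    (hsrc G).

Lemma hwf_mark ar G : ar u = 1 -> hwf ar G -> hwf ar (mark G).
Proof. by move=> aru [uS uE]; split=> // -[e|v] /=; [apply: uE | rewrite aru]. Qed.

Lemma hiso_mark G H : hiso G H -> hiso (mark G) (mark H).
Proof.
case=> fv [fe [bv [be [el [ei es]]]]].
have sP v : (fv v \notin hsrc H) = (v \notin hsrc G).
  by rewrite es mem_map //; apply: bij_inj bv.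
pose fs (v : {v : hV G | v \notin hsrc G}) : {v : hV H | v \notin hsrc H} :=
  exist _ (fv (val v)) (etrans (sP (val v)) (valP v)).
exists fv, (fun x => match x with inl e => inl (fe e) | inr v => inr (fs v) end).
split=> //; split; last first.
  by split; [case | split=> // -[]].
apply: inj_surj_bij.
  move=> [e|v] [e'|v'] // [] => [/(bij_inj be)->//|/(bij_inj bv) h].
  by congr inr; apply: val_inj.
have [fe' _ feK] := be; have [fv' _ fvK] := bv.
case=> [e|v]; first by exists (inl (fe' e)); rewrite feK.
have vP : fv' (val v) \notin hsrc G by rewrite -sP fvK (valP v).
by exists (inr (exist _ (fv' (val v)) vP)); congr inr; apply: val_inj; rewrite /= fvK.
Qed.

Lemma hiso_mark_hunit ar a : hiso (hunit ar a) (mark (hunit ar a)).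
Proof.
exists id, inl; split; first by exists id.
split; last by split=> //; split=> [e|]; rewrite /= map_id.
apply: inj_surj_bij => [? ? []//|[e|v]]; first by exists e.
by have := valP v; rewrite /= mem_enum.
Qed.

Definition unary_edge : hgraph A := @HG A unit unit (fun=> u) (fun=> [:: tt]) [:: tt].

Lemma hiso_unary_edge ar : ar u = 1 -> hiso (hunit ar u) unary_edge.
Proof.
move=> aru; exists (fun=> tt), id.
have card1 (i : 'I_(ar u)) : val i = 0 by case: i => i /=; rewrite aru; case: i.
have enumE : enum 'I_(ar u) = [:: cast_ord (esym aru) ord0].
  apply: (inj_map val_inj); transitivity (iota 0 1) => //.
  by rewrite val_enum_ord aru.
split.
  apply: inj_surj_bij => [i j _|[]]; first by apply: val_inj; rewrite /= !card1.
  by exists (cast_ord (esym aru) ord0).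
split; first by exists id.
by split=> //; split=> [e|]; rewrite /= enumE.
Qed.

(** Marking on both levels. An outer marker must itself be labelled by a hypergraph, and
    [unary_edge] is the unit of [u] up to isomorphism. *)
Definition mark2 (G : hgraph (hgraph A)) : hgraph (hgraph A) :=
  @HG (hgraph A) (hV G) (hE G + {v : hV G | v \notin hsrc G})%type
    (fun x => match x with inl e => mark (hlab G e) | inr _ => unary_edge end)
    (fun x => match x with inl e => hinc G e | inr v => [:: val v] end)
    (hsrc G).

Lemma hwf2_mark2 ar G : ar u = 1 -> hwf2 ar G -> hwf2 ar (mark2 G).
Proof.
move=> aru [[uS uE] wl]; split.
  by split=> // -[e|v] //=; apply: uE.
move=> [e|v]; first exact: hwf_mark.
by split=> // e /=; rewrite aru.
Qed.

Lemma map_pmap_omap (X Y Z : Type) (f : X -> option Y) (g : Y -> Z) s :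
  map g (pmap f s) = pmap (fun x => omap g (f x)) s.
Proof. by elim: s => //= x s IH; case: (f x) => //= y; rewrite IH. Qed.

Section FlattenMark.
Variable G : hgraph (hgraph A).

Let fv (y : flatV G) : flatV (mark2 G) :=
  match y with
  | inl v => inl v
  | inr p => inr (existT (fun e => nonsrc (G := mark2 G) e) (inl (tag p)) (tagged p))
  end.

Lemma inl_nonsrc v : (inl v : flatV G) \notin hsrc (Defs.flatten G) -> v \notin hsrc G.
Proof. by apply: contra => vs; apply: map_f. Qed.

Let fe (x : hE (mark (Defs.flatten G))) : flatE (mark2 G) :=
  match x with
  | inl p => existT (fun e => hE (inner (G := mark2 G) e)) (inl (tag p)) (inl (tagged p))
  | inr (exist (inl v) h) =>
      existT (fun e => hE (inner (G := mark2 G) e)) (inr (exist _ v (inl_nonsrc h))) tt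
  | inr (exist (inr p) h) =>
      existT (fun e => hE (inner (G := mark2 G) e)) (inl (tag p)) (inr (tagged p))
  end.

Lemma flat_vert_mark2 (e : hE G) (v : hV (inner e)) :
  flat_vert (G := mark2 G) (e := inl e) v = omap fv (flat_vert v).
Proof.
have -> : flat_vert (G := mark2 G) (e := inl e) v =
    if (insub v : option (nonsrc e)) is Some w
    then Some (inr (existT (fun e => nonsrc (G := mark2 G) e) (inl e) w))
    else omap inl (nth None (map Some (hinc G e)) (index v (hsrc (inner e)))) by [].
by rewrite /flat_vert; case: (insub v) => [w|] //=; case: (nth _ _ _).
Qed.

(** Partial inverses give injectivity through [pcan_inj], without inverting equations between
    dependent pairs. *)
Let fv_inv (y : flatV (mark2 G)) : option (flatV G) :=
  match y with
  | inl v => Some (inl v)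
  | inr (existT (inl e) w) => Some (inr (existT _ e w))
  | inr (existT (inr _) _) => None
  end.

Let fe_inv (x : flatE (mark2 G)) : option (hE (mark (Defs.flatten G))) :=
  match x with
  | existT (inl e) (inl f) => Some (inl (existT _ e f))
  | existT (inl e) (inr w) => omap inr (insub (inr (existT _ e w) : flatV G))
  | existT (inr v) _ => omap inr (insub (inl (val v) : flatV G))
  end.

(** A vertex [inl v] of the flattening is marked by the outer marker of [v], a vertex inside a label
    by the marker placed in that label. *)
Lemma flatten_mark2 : hiso (mark (Defs.flatten G)) (Defs.flatten (mark2 G)).
Proof.
exists fv, fe; split.
  apply: inj_surj_bij; first by apply: (pcan_inj (g := fv_inv)) => -[v|[e w]].
  move=> [v|[[e|v] w]]; first by exists (inl v).
    by exists (inr (existT _ e w)).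
  (* The only vertex of [unary_edge] is its source, so it adds no vertex to the flattening. *)
  by case: w => -[].
split.
  apply: inj_surj_bij.
    apply: (pcan_inj (g := fe_inv)) => -[[e f]|[[v|[e w]] h]] //=;
      by rewrite insubT.
  move=> [[e|v] f].
    case: f => [f|w]; first by exists (inl (existT _ e f)).
    have h : (inr (existT _ e w) : flatV G) \notin hsrc (Defs.flatten G).
      by apply/negP => /mapP[].
    by exists (inr (exist (fun y : flatV G => y \notin hsrc (Defs.flatten G)) _ h)).
  have h : (inl (val v) : flatV G) \notin hsrc (Defs.flatten G).
    by apply: contra (valP v) => /mapP[w ws [E]]; have -> : val v = w := E.
  exists (inr (exist (fun y : flatV G => y \notin hsrc (Defs.flatten G)) _ h)); case: f; case: v h => v v' h /=.
  by rewrite (bool_irrelevance (inl_nonsrc h) v').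
split; first by case=> [[e f]|[[v|[e w]] h]].
split; last by rewrite /= -map_comp.
case=> [[e f]|[[v|[e w]] h]] //=.
  rewrite map_pmap_omap; apply: eq_pmap => v; exact: flat_vert_mark2.
  by rewrite /flat_vert insubF.
transitivity (pmap (@flat_vert _ (mark2 G) (inl e)) [:: val w]) => //.
rewrite [LHS]/pmap flat_vert_mark2.
by case: w {h} => w hw; rewrite (flat_vert_nonsrc hw).
Qed.
End FlattenMark.
End Mark.

Section MarkAlg.
Variables (B : calg) (u : B).
Hypothesis ar_u : car_ar u = 1.
Local Notation ar := (@car_ar B).

Definition mark_pi (G : hgraph B) : B := car_pi (mark u G).

Lemma mark_alg : is_Halg ar mark_pi.
Proof.
have [arP [isoP [unitP assocP]]] := car_alg B.
have wm G := @hwf_mark _ u ar G ar_u.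
split; [|split; [|split]].
- by move=> G /wm/arP.
- by move=> G H wG iso; apply: isoP; [apply: wm | apply: hiso_mark].
- move=> a; rewrite -[RHS]unitP; symmetry; apply: isoP; last exact: hiso_mark_hunit.
  by split=> [|e]; rewrite /= enum_uniq ?size_enum_ord.
- move=> G wG.
  have w1 : hwf ar (hunit ar u).
    by split=> [|e]; rewrite /= enum_uniq ?size_enum_ord.
  have w2 := hwf2_mark2 ar_u wG.
  (* The outer label [u] is rewritten as the product of [unary_edge], which brings both sides to
     products of [mark2 u G], where associativity of [B] applies. *)
  transitivity (car_pi (hmap (@car_pi B) (mark2 u G))).
    rewrite /mark_pi /mark /hmap /=; congr (car_pi (HG _ _ _)).
    apply: funext => -[e|v] //; rewrite -(isoP _ _ w1 (hiso_unary_edge ar_u)).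
    by rewrite unitP.
  rewrite assocP //; symmetry; apply: isoP; last exact: flatten_mark2.
  exact/wm/(hwf_flatten wG).
Qed.

Definition mark_rpi (r : rep B) : B :=
  car_rpi (r.1, (r.2.1, r.2.2 ++
    [seq (u, [:: v]) | v <- [seq v <- iota 0 r.1 | v \notin r.2.1]])).

Lemma cmp_mark_rpi : computable mark_rpi.
Proof.
apply: cmp_comp (cmp_car_rpi B) _; cmp.
apply: cmp_cat; cmp.
apply: (cmp_map (F := fun (_ : rep B) (v : nat) => (u, [:: v]))); cmp.
apply: cmp_filter; last by apply: cmp_iota; cmp.
by apply: cmp_neg; apply: cmp_mem; cmp.
Qed.

Lemma mark_rpiP (G : hgraph B) fv es : hwf ar G ->
  @numbering _ G fv es -> mark_rpi (rep_of fv es) = mark_pi G.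
Proof.
move=> wG nG; have [l lE lP] := numbering_enum nG.
have [fvI fvlt ues ees] := nG.
pose ls : seq {v : hV G | v \notin hsrc G} := pmap insub l.
have lsE : map val ls = [seq v <- l | v \notin hsrc G].
  rewrite /ls (pmap_filter (insubK _)); apply: eq_filter => v /=.
  exact: isSome_insub.
(* Markers follow the original hyperedges, in the order of the vertex numbers, exactly as [mark_rpi]
   appends them. *)
pose es' : seq (hE (mark u G)) := map inl es ++ map inr ls.
have nG' : @numbering _ (mark u G) fv es'.
  split=> //.
    rewrite cat_uniq !map_inj_uniq; [|by move=> ? ? []|by move=> ? ? []].
    rewrite ues -(map_inj_uniq val_inj) lsE filter_uniq ?andbT //=.
      by apply/hasPn => _ /mapP[v _ ->]; apply/negP => /mapP[].
    by rewrite (perm_uniq lP) enum_uniq.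
  case=> [e|v]; rewrite mem_cat; first by rewrite map_f.
  rewrite [X in _ || X]map_f ?orbT //.
  by rewrite -(mem_map val_inj) lsE mem_filter (valP v) (perm_mem lP) mem_enum.
rewrite /mark_pi -(car_rpiP (hwf_mark ar_u wG) nG') /mark_rpi /rep_of /=.
congr (car_rpi (_, (_, _))); rewrite map_cat -!map_comp; congr cat.
have -> : [seq v <- iota 0 #|hV G| | v \notin [seq fv i | i <- hsrc G]] =
    map fv (map val ls).
  rewrite -lE lsE filter_map; congr map; apply: eq_filter => v /=.
  by rewrite mem_map.
by rewrite -!map_comp.
Qed.

Definition mark_calg : calg :=
  CAlg mark_alg (@car_enc_inj B) (@car_all_uniq B) (@mem_car_all B) (cmp_car_all B)
    cmp_mark_rpi mark_rpiP.
End MarkAlg.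

(** * Algebras of vertex weights *)

Lemma cmp_fin2 (T1 T2 : finType) Y (eY : Enc Y) (f : T1 -> T2 -> Y) :
  computable (eX := enc_prod (enc_fin T1) (enc_fin T2)) (fun p => f p.1 p.2).
Proof.
have [[x0 y0] _|T0] := pickP (fun _ : T1 * T2 => true); last first.
  by exists id => [|x]; [exact: rc_id | have := T0 x].
pose s := [seq [seq f x y | y <- enum T2] | x <- enum T1].
apply: (cmp_ext (f := fun p => nth (f x0 y0) (nth [::] s (enc_fin T1 p.1)) (enc_fin T2 p.2))).
  have lt (T : finType) (x : T) : enc_fin T x < size (enum T).
    by rewrite -cardE; apply: ltn_ord.
  by move=> [x y]; rewrite /s (nth_map x0) // (nth_map y0) // !nth_enum_rank.
apply: cmp_nth; first by cmp.
  apply: cmp_nth; try by cmp.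
  exact: (cmp_enc (cmp_fst (@cmp_id _ (enc_prod (enc_fin T1) (enc_fin T2))))).
exact: (cmp_enc (cmp_snd (@cmp_id _ (enc_prod (enc_fin T1) (enc_fin T2))))).
Qed.

Section Weights.
Variables (N K : finType) (zN : N) (zK : K).
Variables (aN : Monoid.com_law zN) (aK : Monoid.com_law zK) (beta : N -> K).

(* An n-ary element is a global weight together with the weights of the n
   sources; a vertex that stops being a source contributes [beta] of its weight
   to the global one. *)
Definition weights : eqType := (K * seq N)%type.
Definition wt_ar (a : weights) : nat := size a.2.

(** If [v] is not incident to [e], its index is the length of the incidence list; in a well-formed
    hypergraph this is past the end of the weights, and the default [zN] is neutral. *)
Definition vweight (G : hgraph weights) (v : hV G) : N :=
  \big[aN/zN]_(e : hE G) nth zN (hlab G e).2 (index v (hinc G e)).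

Definition wt_pi (G : hgraph weights) : weights :=
  (aK (\big[aK/zK]_(e : hE G) (hlab G e).1)
      (\big[aK/zK]_(v | v \notin hsrc G) beta (vweight v)),
   map (@vweight G) (hsrc G)).

Lemma vweight_iso G H fv fe : injective fv -> bijective fe ->
  (forall e, hlab H (fe e) = hlab G e) ->
  (forall e, hinc H (fe e) = map fv (hinc G e)) ->
  forall v : hV G, vweight (fv v : hV H) = vweight v.
Proof.
move=> fvI be el ei v; rewrite /vweight (reindex fe) /=; last exact: onW_bij.
by apply: eq_bigr => e _; rewrite el ei index_map.
Qed.

Lemma wt_pi_iso G H : hiso G H -> wt_pi G = wt_pi H.
Proof.
case=> fv [fe [bv [be [el [ei es]]]]].
have fvI := bij_inj bv.
have E := vweight_iso fvI be el ei.
rewrite /wt_pi; congr (aK _ _, _).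
- rewrite [RHS](reindex fe) /=; last exact: onW_bij.
  by apply: eq_bigr => e _; rewrite el.
- rewrite [RHS](reindex fv) /=; last exact: onW_bij.
  by apply: eq_big => v; rewrite ?es ?mem_map // E.
by rewrite es -map_comp; apply: eq_map => v /=; rewrite E.
Qed.

Lemma wt_pi_unit a : wt_pi (hunit wt_ar a) = a.
Proof.
case: a => k t; rewrite /wt_pi /= [X in aK _ X]big_pred0; last by move=> v; rewrite mem_enum.
have one (R : Type) (z : R) (op : Monoid.com_law z) (F : unit -> R) :
    \big[op/z]_(x : unit) F x = F tt.
  by rewrite (big_pred1 tt) // => -[].
rewrite one Monoid.mulm1; congr pair.
apply: (@eq_from_nth _ zN); first by rewrite size_map size_enum_ord.
move=> i; rewrite size_map size_enum_ord => lt.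
rewrite (nth_map (Ordinal lt)) ?size_enum_ord // /vweight one /=.
by rewrite index_uniq ?enum_uniq ?size_enum_ord.
Qed.

(** * Associativity of the product of weights *)

Section WeightAssoc.
Variable G : hgraph (hgraph weights).
Hypothesis wG : hwf2 wt_ar G.
Local Notation F := (Defs.flatten G).

Lemma nth_notin (e : hE G) f y : y \notin hinc F (existT _ e f) ->
  nth zN (hlab (inner e) f).2 (index y (hinc F (existT _ e f))) = zN.
Proof.
move=> yn; have [_ /(_ (existT _ e f))[_ sz]] := hwf_flatten wG.
by rewrite nth_default // memNindex // sz.
Qed.

Lemma vweight_flatten (y : hV F) :
  vweight y = \big[aN/zN]_(e : hE G) \big[aN/zN]_(f : hE (inner e))
     nth zN (hlab (inner e) f).2 (index y (hinc F (existT _ e f))).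
Proof.
rewrite sig_big_dep; apply: eq_big => [//|[e f] _]; congr nth.
Qed.

Lemma inner_vweight (e : hE G) (v : hV (inner e)) :
  \big[aN/zN]_(f : hE (inner e))
     nth zN (hlab (inner e) f).2 (index (flat_pos wG v) (hinc F (existT _ e f)))
  = vweight v.
Proof.
apply: eq_bigr => f _; rewrite (flatten_inc wG) index_map //.
exact: flat_pos_inj.
Qed.

Lemma inner_vweight0 (e : hE G) y : (forall v : hV (inner e), flat_pos wG v <> y) ->
  \big[aN/zN]_(f : hE (inner e))
     nth zN (hlab (inner e) f).2 (index y (hinc F (existT _ e f))) = zN.
Proof.
move=> yn; rewrite big1 // => f _; rewrite nth_notin // (flatten_inc wG).
by apply/mapP => -[v _ E]; apply: (yn v).
Qed.

(** A vertex private to the label of [e] is met only by hyperedges of that label. *)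
Lemma vweight_flatten_inr (e : hE G) (w : nonsrc e) :
  vweight (inr (existT _ e w) : hV F) = vweight (val w).
Proof.
rewrite vweight_flatten (bigD1 e) //= [X in aN _ X]big1 ?Monoid.mulm1.
  rewrite -inner_vweight; case: w => w hw; by rewrite (flat_pos_nonsrc wG hw).
move=> e' ne; apply: inner_vweight0 => v.
case: (boolP (v \in hsrc (inner e'))) => [/(flat_pos_src wG)[? _ ->]//|h].
rewrite (flat_pos_nonsrc wG h) => -[E]; by rewrite E eqxx in ne.
Qed.

(** Inside the label of [e], the outer vertex [v] appears as the source at the position of [v] in
    the incidence list of [e]. The weight of that source in the label is what [e] contributes to
    [v]. *)
Lemma vweight_flatten_inl (v : hV G) :
  vweight (inl v : hV F) = vweight (v : hV (hmap wt_pi G)).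
Proof.
rewrite vweight_flatten; apply: eq_bigr => e _ /=.
have [_ /(_ e)[ue se]] := wG.1.
case: (boolP (v \in hinc G e)) => [ve|vn]; last first.
  rewrite inner_vweight0.
    by rewrite nth_default // size_map memNindex // se.
  move=> w; case: (boolP (w \in hsrc (inner e))) => [|h]; last first.
    by rewrite (flat_pos_nonsrc wG h).
  by case/(flat_pos_src wG)=> x /andP[xe _] -> [E]; rewrite -E xe in vn.
have lt : index v (hinc G e) < size (hsrc (inner e)).
  by rewrite -[size _]/(harity (hlab G e)) -se index_mem.
have [w0 _] : exists w, w \in hsrc (inner e).
  by case: (hsrc (inner e)) lt => // w l _; exists w; rewrite inE eqxx.
set w := nth w0 (hsrc (inner e)) (index v (hinc G e)).
have [x /andP[xe /eqP xi] E] := flat_pos_src wG (mem_nth w0 lt).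
have [uS _] := wG.2 e.
have xv : x = v.
  rewrite -(nth_index v xe) xi index_uniq // nth_index //.
by rewrite (nth_map w0) // -inner_vweight E xv.
Qed.

(** A non-source vertex of the flattening is forgotten once, either in its label or in the outer
    hypergraph, with the same weight; the sum of the [beta] terms splits accordingly. *)
Lemma wt_pi_assoc : wt_pi (hmap wt_pi G) = wt_pi F.
Proof.
rewrite /wt_pi /=; congr pair; last first.
  rewrite -map_comp; apply: eq_map => v /=; by rewrite vweight_flatten_inl.
rewrite big_split /= -Monoid.mulmA; congr (aK _ _).
  by rewrite sig_big_dep.
rewrite big_sumType /= Monoid.mulmC; congr (aK _ _).
  apply: eq_big => v; last by rewrite vweight_flatten_inl.
  by rewrite mem_map // => ? ? [].
transitivity (\big[aK/zK]_(e : hE G) \big[aK/zK]_(w : nonsrc e)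
   beta (vweight (inr (existT _ e w) : hV F))).
  apply: eq_bigr => e _.
  rewrite (big_sub (fun v => v \notin hsrc (inner e))); apply: eq_bigr => w _.
  by rewrite vweight_flatten_inr.
rewrite sig_big_dep; apply: eq_big => [[e w]|[e w] _] //=.
by symmetry; apply/mapP => -[].
Qed.
End WeightAssoc.

Lemma wt_alg : is_Halg wt_ar wt_pi.
Proof.
split; first by move=> G _; rewrite /wt_ar /= size_map.
split; first by move=> G H _; apply: wt_pi_iso.
by split; [exact: wt_pi_unit | exact: wt_pi_assoc].
Qed.

(** * Listing the weights and computing their products *)

#[local] Instance encN : Enc N := enc_fin N.
#[local] Instance encK : Enc K := enc_fin K.
#[local] Instance wt_enc : Enc weights := enc_prod encK (enc_seq encN).

Lemma wt_enc_inj : injective wt_enc.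
Proof. by apply: enc_prod_inj; [|apply: enc_seq_inj]; apply: enc_fin_inj. Qed.

Definition words (n : nat) : seq (seq N) :=
  iter n (fun L => [seq x :: t | x <- enum N, t <- L]) [:: [::]].

Definition wt_all (n : nat) : seq weights := [seq (k, t) | k <- enum K, t <- words n].

Lemma mem_words n t : (t \in words n) = (size t == n).
Proof.
elim: n t => [|n IH] t /=; first by rewrite inE size_eq0.
apply/allpairsP/idP => [[[x u] /= [_ un ->]]|].
  by rewrite /= eqSS -IH.
by case: t => // x u /=; rewrite eqSS -IH => un; exists (x, u); rewrite mem_enum.
Qed.

Lemma words_uniq n : uniq (words n).
Proof.
elim: n => //= n IH; apply: allpairs_uniq => //; first exact: enum_uniq.
by move=> [x t] [y u] _ _ /= [-> ->].
Qed.

Lemma wt_all_uniq n : uniq (wt_all n).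
Proof.
apply: allpairs_uniq; [exact: enum_uniq | exact: words_uniq |].
by move=> [x t] [y u] _ _ /= [-> ->].
Qed.

Lemma mem_wt_all n a : (a \in wt_all n) = (wt_ar a == n).
Proof.
rewrite /wt_ar -mem_words; apply/allpairsP/idP => [[[k t] /= [_ h ->]]|h] //.
by exists a; rewrite mem_enum -surjective_pairing.
Qed.

Lemma cmp_wt_all : computable wt_all.
Proof.
rewrite /wt_all; apply: cmp_flatten.
apply: (cmp_map (F := fun n k => [seq (k, t) | t <- words n])); last by cmp.
apply: (cmp_map (F := fun (p : nat * K) t => (p.2, t))); cmp.
apply: (cmp_iter (F := fun (_ : nat * K) L => [seq x :: t | x <- enum N, t <- L])); cmp.
apply: cmp_flatten.
apply: (cmp_map (F := fun (p : (nat * K) * seq (seq N)) x => [seq x :: t | t <- p.2])); last by cmp.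
by apply: (cmp_map (F := fun (q : ((nat * K) * seq (seq N)) * N) t => q.2 :: t)); cmp.
Qed.

Definition vweight_rep (es : seq (weights * seq nat)) (v : nat) : N :=
  foldr aN zN [seq nth zN e.1.2 (index v e.2) | e <- es].

Definition wt_rpi (r : rep weights) : weights :=
  (aK (foldr aK zK [seq e.1.1 | e <- r.2.2])
      (foldr aK zK [seq beta (vweight_rep r.2.2 v)
                      | v <- [seq v <- iota 0 r.1 | v \notin r.2.1]]),
   [seq vweight_rep r.2.2 v | v <- r.2.1]).

Lemma cmp_vweight_rep X (eX : Enc X) (es : X -> seq (weights * seq nat)) (v : X -> nat) :
  computable es -> computable v -> computable (fun x => vweight_rep (es x) (v x)).
Proof.
move=> ces cv.
apply: (cmp_foldr (F := fun _ => aN)); [|by cmp|].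
  by apply: (cmp_comp2 (cmp_fin2 encN aN)); cmp.
apply: (cmp_map (F := fun x (e : weights * seq nat) => nth zN e.1.2 (index (v x) e.2))) => //.
apply: cmp_nth; cmp.
apply: cmp_index => //; cmp.
by apply: cmp_comp cv _; cmp.
Qed.

Lemma cmp_wt_rpi : computable wt_rpi.
Proof.
rewrite /wt_rpi; cmp.
  apply: (cmp_comp2 (cmp_fin2 encK aK)).
    apply: (cmp_foldr (F := fun _ => aK)); [|by cmp|].
      by apply: (cmp_comp2 (cmp_fin2 encK aK)); cmp.
    by apply: (cmp_map (F := fun _ (e : weights * seq nat) => e.1.1)); cmp.
  apply: (cmp_foldr (F := fun _ => aK)); [|by cmp|].
    by apply: (cmp_comp2 (cmp_fin2 encK aK)); cmp.
  apply: (cmp_map (F := fun (r : rep weights) v => beta (vweight_rep r.2.2 v))).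
    by apply: (cmp_comp (cmp_fin encK beta)); apply: cmp_vweight_rep; cmp.
  apply: cmp_filter; last by apply: cmp_iota; cmp.
  by apply: cmp_neg; apply: cmp_mem; cmp.
apply: (cmp_map (F := fun (r : rep weights) v => vweight_rep r.2.2 v)); cmp.
by apply: cmp_vweight_rep; cmp.
Qed.

Lemma big_all_seq (R : Type) (z : R) (op : Monoid.com_law z) (I : finType) (s : seq I)
    (P : pred I) (f : I -> R) :
  uniq s -> (forall i, i \in s) ->
  \big[op/z]_(i <- s | P i) f i = \big[op/z]_(i | P i) f i.
Proof.
move=> us sP; apply: perm_big; apply: uniq_perm => //; first exact: index_enum_uniq.
by move=> i; rewrite sP mem_index_enum.
Qed.

Lemma wt_rpiP (G : hgraph weights) fv es : hwf wt_ar G ->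
  @numbering _ G fv es -> wt_rpi (rep_of fv es) = wt_pi G.
Proof.
move=> wG nG; have [l lE lP] := numbering_enum nG.
have [fvI fvlt ues ees] := nG.
have E v : vweight_rep (rep_of fv es).2.2 (fv v) = vweight v.
  rewrite /vweight_rep foldrE big_map big_map big_all_seq //.
  by apply: eq_bigr => e _ /=; rewrite index_map.
rewrite /wt_rpi /wt_pi; congr (aK _ _, _).
- by rewrite foldrE big_map big_map big_all_seq.
- rewrite foldrE big_map big_filter -lE big_map big_all_seq.
  + by apply: eq_big => v; rewrite /= ?mem_map // -E.
  + by rewrite (perm_uniq lP) enum_uniq.
  + by move=> v; rewrite (perm_mem lP) mem_enum.
by rewrite /= -map_comp; apply: eq_map => v; rewrite -E.
Qed.

Definition wt_calg : calg :=
  CAlg wt_alg wt_enc_inj wt_all_uniq mem_wt_all cmp_wt_all cmp_wt_rpi wt_rpiP.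
End Weights.

(** * Counting up to a threshold and a modulus *)

Section Counting.
Variables T M : nat.

(** The quotient of the naturals with tail of length [T] and period [M.+1]; the successor keeps the
    period positive. *)
Definition truncate (n : nat) : nat := if n < T then n else T + (n - T) %% M.+1.

Lemma truncate_lt n : truncate n < (T + M).+1.
Proof.
rewrite /truncate; case: ifP => h; first by lia.
by rewrite ltnS leq_add2l -ltnS ltn_mod.
Qed.

Lemma truncateD a b : truncate (truncate a + b) = truncate (a + b).
Proof.
rewrite {2}/truncate; case: ltnP => h //; rewrite /truncate.
rewrite !ltnNge !(leq_trans _ (leq_addr _ _)) //= ?leq_addr //.
by rewrite -addnA addKn modnDml addnBAC.
Qed.

Lemma truncate_eq a b : truncate a = truncate b ->
  a = b \/ [/\ T <= a, T <= b & a = b %[mod M.+1]].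
Proof.
rewrite /truncate; case: (ltnP a T) => ha; case: (ltnP b T) => hb e; [by left|lia|lia|].
right; split=> //; move/addnI: e => /eqP.
by rewrite -(eqn_modDl T) !subnKC // => /eqP.
Qed.

Definition count_mod : finType := 'I_(T + M).+1.
Definition cnt (n : nat) : count_mod := Ordinal (truncate_lt n).

Lemma cnt_val (x : count_mod) : cnt (val x) = x.
Proof.
apply: val_inj => /=; rewrite /truncate; case: ltnP => h //.
by rewrite modn_small ?subnKC // ltn_subLR // addnS ltn_ord.
Qed.

Lemma cnt_eq a b : cnt a = cnt b ->
  a = b \/ [/\ T <= a, T <= b & a = b %[mod M.+1]].
Proof. by case=> /truncate_eq. Qed.

Variable D : finType.

Definition counts : finType := {ffun D -> count_mod}.
Definition mkcounts (f : D -> nat) : counts := [ffun x => cnt (f x)].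
Definition counts_add (f g : counts) : counts := mkcounts (fun x => val (f x) + val (g x)).

Lemma mkcountsD f g : counts_add (mkcounts f) (mkcounts g) = mkcounts (fun x => f x + g x).
Proof.
apply/ffunP => x; rewrite !ffunE; apply: val_inj => /=.
by rewrite truncateD addnC truncateD addnC.
Qed.

(** Every element is the truncation of honest counts, which reduces associativity and the unit law
    to those of addition. *)
Lemma mkcountsP (f : counts) : f = mkcounts (fun x => val (f x)).
Proof. by apply/ffunP => x; rewrite ffunE cnt_val. Qed.

Definition counts0 : counts := mkcounts (fun=> 0).

Lemma counts_addA : associative counts_add.
Proof.
move=> f g h; rewrite (mkcountsP f) (mkcountsP g) (mkcountsP h) !mkcountsD.
by apply/ffunP => x; rewrite !ffunE addnA.
Qed.

Lemma counts_addC : commutative counts_add.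
Proof. by move=> f g; apply/ffunP => x; rewrite !ffunE addnC. Qed.

Lemma counts_add0 : left_id counts0 counts_add.
Proof. by move=> f; rewrite (mkcountsP f) mkcountsD; apply/ffunP => x; rewrite !ffunE. Qed.

HB.instance Definition _ :=
  Monoid.isComLaw.Build counts counts0 counts_add counts_addA counts_addC counts_add0.

Lemma big_mkcounts (I : finType) (P : pred I) (F : I -> D -> nat) :
  \big[counts_add/counts0]_(i | P i) mkcounts (F i) =
  mkcounts (fun x => \sum_(i | P i) F i x).
Proof.
apply/ffunP => x; rewrite [RHS]ffunE.
elim/big_ind2: _ => [|f a g b Hf Hg|i _]; rewrite ffunE //.
apply: val_inj; rewrite Hf Hg /=.
by rewrite truncateD addnC truncateD addnC.
Qed.
End Counting.

Lemma cnt_sum T M (I : finType) (P : pred I) (f g : I -> nat) :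
  (forall i, cnt T M (f i) = cnt T M (g i)) ->
  cnt T M (\sum_(i | P i) f i) = cnt T M (\sum_(i | P i) g i).
Proof.
move=> fg; elim/big_ind2: _ => // a b c d [/= ab] [/= cd]; apply: val_inj => /=.
by rewrite -truncateD ab truncateD addnC -truncateD cd truncateD addnC.
Qed.

(** * Types of coloured hypergraphs *)

Section Types.
Variables (Sigma : finType) (arS : Sigma -> nat) (d T M : nat).

(* The letter [None] marks vertices. *)
Definition arO (c : option Sigma) : nat := if c is Some a then arS a else 1.

(** The successor makes room for the marker, which has arity 1 even when all arities in [Sigma] are
    0. *)
Definition max_ar : nat := (\max_a arS a).+1.

Lemma leq_max_ar c : arO c <= max_ar.
Proof. by case: c => //= a; rewrite leqW // leq_bigmax. Qed.

Definition letter : finType := (option Sigma * {ffun 'I_d -> bool})%type.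
Definition vtype : finType := counts T M (letter * 'I_max_ar.+1)%type.
Definition gtype : finType := counts T M (letter + vtype)%type.

Definition count_vtype (t : vtype) : gtype :=
  mkcounts T M (fun x : letter + vtype => x == inr t : nat).

Definition base_calg : calg :=
  wt_calg (@counts_add T M (letter * 'I_max_ar.+1)%type)
    (@counts_add T M (letter + vtype)%type) count_vtype.

(** A single hyperedge: it counts once globally, and its source number [i] sees it once, at position
    [i]. *)
Definition letter_elt (c : letter) : base_calg :=
  (mkcounts T M (fun x : letter + vtype => x == inl c : nat),
   [seq mkcounts T M (fun y : letter * 'I_max_ar.+1 => y == (c, inord i) : nat)
      | i <- iota 0 (arO c.1)]).

Fixpoint tower (j : nat) : calg :=
  if j is i.+1 then powerset_calg (tower i) else base_calg.

Definition restrict (b : nat -> bool) : {ffun 'I_d -> bool} := [ffun i : 'I_d => b i].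

(* At level [j] the colours [0, ..., j-1] are still to be guessed. *)
Fixpoint colour_elt (j : nat) : option Sigma -> (nat -> bool) -> tower j :=
  match j return option Sigma -> (nat -> bool) -> tower j with
  | 0 => fun c b => letter_elt (c, restrict b)
  | i.+1 => fun c b => mkpset (arO c)
      (pred2 (colour_elt i c (upd b i false)) (colour_elt i c (upd b i true)))
  end.

Lemma colour_elt_ar j c b : car_ar (colour_elt j c b) = arO c.
Proof. by case: j => //=; rewrite /wt_ar /= size_map size_iota. Qed.

Lemma mem_colour_elt j c b x :
  (x \in pset_elts (colour_elt j.+1 c b)) <->
  exists t, x = colour_elt j c (upd b j t).
Proof.
rewrite [colour_elt _ _ _]/= mem_mkpset /=; split=> [/andP[_ /orP[]/eqP->]|[t ->]].
- by exists false.
- by exists true.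
by rewrite colour_elt_ar eqxx; case: t; rewrite eqxx ?orbT.
Qed.

Definition type j (G : hgraph (option Sigma)) (chi : hE G -> nat -> bool) : tower j :=
  car_pi (relab (fun e => colour_elt j (hlab G e) (chi e))).

Lemma hwf_colour j G (chi : hE G -> nat -> bool) :
  hwf arO G -> hwf (@car_ar (tower j)) (relab (fun e => colour_elt j (hlab G e) (chi e))).
Proof. by case=> uS uE; split=> // e; rewrite /= colour_elt_ar; apply: uE. Qed.

Lemma mem_type j G (chi : hE G -> nat -> bool) x : hwf arO G ->
  (x \in pset_elts (type j.+1 chi)) <->
  exists U : hE G -> bool, x = type j (fun e => upd (chi e) j (U e)).
Proof.
move=> wG; rewrite /type [car_pi]/= mem_pset_pi; last exact: (@hwf_colour j.+1 _ _ wG).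
split=> [[s ss <-]|[U ->]].
  have ex e : exists t, s e = colour_elt j (hlab G e) (upd (chi e) j t).
    by apply/mem_colour_elt; apply: ss.
  exists (fun e => sval (cid (ex e))); congr car_pi; congr HG.
  by apply: funext => e; case: cid.
exists (fun e => colour_elt j (hlab G e) (upd (chi e) j (U e))) => // e.
by apply/mem_colour_elt; exists (U e).
Qed.

(** The back-and-forth step: equal types at level [j.+1] are equal sets of types at level [j], so
    every choice of colour [j] in [G] has an answer in [H]. *)
Lemma type_step j G H (chi : hE G -> nat -> bool) (chi' : hE H -> nat -> bool) :
  hwf arO G -> hwf arO H -> type j.+1 chi = type j.+1 chi' ->
  forall U : hE G -> bool, exists U' : hE H -> bool,
    type j (fun e => upd (chi e) j (U e)) = type j (fun e => upd (chi' e) j (U' e)).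
Proof.
move=> wG wH E U; apply/mem_type => //; rewrite -E; apply/mem_type => //.
by exists U.
Qed.

(** Colours not yet guessed are filled in by dummy moves, constantly false in [G] and answered in
    [H]. Colours from [j] on are untouched, so atomic formulas can be decided at level 0. *)
Lemma type_descend j G H (chi : hE G -> nat -> bool) (chi' : hE H -> nat -> bool) :
  hwf arO G -> hwf arO H -> type j chi = type j chi' ->
  exists chi1 chi1', [/\ forall e p, j <= p -> chi1 e p = chi e p,
    forall e p, j <= p -> chi1' e p = chi' e p & @type 0 G chi1 = @type 0 H chi1'].
Proof.
move=> wG wH; elim: j chi chi' => [|j IH] chi chi' E; first by exists chi, chi'.
have [U' /IH[chi1 [chi1' [c1 c1' E1]]]] := type_step wG wH E (fun=> false).
exists chi1, chi1'; split=> // e p jp; rewrite ?c1 ?c1' ?(ltnW jp) // /upd;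
  by rewrite gtn_eqF.
Qed.

Section Level0.
Variables (G : hgraph (option Sigma)) (chi : hE G -> nat -> bool).
Hypotheses (wG : hwf arO G) (G0 : hsrc G = [::]).

Definition letter_of (e : hE G) : letter := (hlab G e, restrict (chi e)).

Definition vtype_of (v : hV G) : vtype :=
  mkcounts T M (fun y : letter * 'I_max_ar.+1 =>
    \sum_(e : hE G) ((v \in hinc G e) && (y == (letter_of e, inord (index v (hinc G e)))) : nat)).

Lemma type0E : @type 0 G chi =
  (mkcounts T M (fun x : letter + vtype =>
     \sum_(e : hE G) (x == inl (letter_of e) : nat) +
     \sum_(v : hV G) (x == inr (vtype_of v) : nat)), [::]).
Proof.
have vE (v : hV G) : @vweight vtype gtype (counts0 T M _)
    (@counts_add T M (letter * 'I_max_ar.+1)%type)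
    (relab (fun e => colour_elt 0 (hlab G e) (chi e))) v = vtype_of v.
  rewrite /vweight /vtype_of -big_mkcounts; apply: eq_bigr => e _ /=.
  have [_ /(_ e)[_ se]] := wG.
  case: (boolP (v \in hinc G e)) => ve; last first.
    by rewrite nth_default // size_map size_iota memNindex // se.
  have lt : index v (hinc G e) < arO (hlab G e) by rewrite -se index_mem.
  by rewrite (nth_map 0) ?size_iota // nth_iota.
rewrite /type /= /wt_pi /= G0 /=; congr pair.
rewrite -mkcountsD -!big_mkcounts; congr counts_add.
by apply: eq_big => v; rewrite ?G0 // vE.
Qed.
End Level0.

Section Transfer.
Variables (G H : hgraph (option Sigma)).
Variables (chi : hE G -> nat -> bool) (chi' : hE H -> nat -> bool).
Hypotheses (wG : hwf arO G) (G0 : hsrc G = [::]) (wH : hwf arO H) (H0 : hsrc H = [::]).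
Hypothesis E : @type 0 G chi = @type 0 H chi'.

Let Ecnt : forall x : letter + vtype,
  cnt T M (\sum_(e : hE G) (x == inl (letter_of chi e) : nat) +
           \sum_(v : hV G) (x == inr (vtype_of chi v) : nat)) =
  cnt T M (\sum_(e : hE H) (x == inl (letter_of chi' e) : nat) +
           \sum_(v : hV H) (x == inr (vtype_of chi' v) : nat)).
Proof.
move=> x; move: E; rewrite !type0E // => /(congr1 fst) /= /ffunP/(_ x).
by rewrite !ffunE.
Qed.

Lemma type0_count (P : pred letter) :
  cnt T M #|[pred e : hE G | P (letter_of chi e)]| =
  cnt T M #|[pred e : hE H | P (letter_of chi' e)]|.
Proof.
have cE (K : hgraph (option Sigma)) (psi : hE K -> nat -> bool) :
    #|[pred e : hE K | P (letter_of psi e)]| =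
    \sum_(c | P c) \sum_(e : hE K) (c == letter_of psi e : nat).
  rewrite -sum1_card exchange_big big_mkcond; apply: eq_bigr => e _ /=.
  rewrite inE; case: ifP => Pe.
    rewrite (bigD1 (letter_of psi e)) //= eqxx big1 // => c /andP[_ /negbTE->] //.
  by rewrite big1 // => c Pc; case: eqP Pc => // ->; rewrite Pe.
rewrite !cE; apply: cnt_sum => c; have := Ecnt (inl c).
by rewrite ![\sum_(v : hV _) _]big1 // !addn0.
Qed.

Hypothesis T_gt1 : 1 < T.

(** With threshold at least 2 the counts 0 and 1 are exact, so emptiness and being a singleton
    transfer. *)
Lemma cnt_small a b : cnt T M a = cnt T M b -> a <= 1 -> a = b.
Proof. by case/cnt_eq=> // -[Ta _ _] a1; lia. Qed.

Lemma sum_gt0_ex (I : finType) (P : pred I) :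
  0 < \sum_i (P i : nat) -> exists i, P i.
Proof.
move=> h; apply/existsP; apply: contraTT h; rewrite negb_exists => /forallP h.
by rewrite -leqNgt leqn0 big1 // => i _; rewrite (negbTE (h i)).
Qed.

Lemma ex_sum_gt0 (I : finType) (P : pred I) i : P i -> 0 < \sum_i (P i : nat).
Proof. by move=> Pi; rewrite (bigD1 i) //= Pi. Qed.

Lemma type0_ex (P : pred letter) e : P (letter_of chi e) ->
  exists e', P (letter_of chi' e').
Proof.
move=> Pe; have /esym/cnt_small := type0_count P.
case: (posnP #|[pred e : hE H | P (letter_of chi' e)]|) => [-> /(_ isT)/esym|].
  by move/card0_eq/(_ e); rewrite inE Pe.
by case/card_gt0P=> e'; exists e'.
Qed.

Lemma type0_incidence e f v i k : v \in hinc G e -> index v (hinc G e) = i ->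
  v \in hinc G f -> index v (hinc G f) = k ->
  exists e' f' v', [/\ letter_of chi' e' = letter_of chi e,
    letter_of chi' f' = letter_of chi f,
    (v' \in hinc H e') && (index v' (hinc H e') == i) &
    (v' \in hinc H f') && (index v' (hinc H f') == k)].
Proof.
move=> ve vi vf vk.
have [v' E'] : exists v' : hV H, vtype_of chi v == vtype_of chi' v'.
  apply: (@sum_gt0_ex _ (fun v' : hV H => vtype_of chi v == vtype_of chi' v')).
  have := Ecnt (inr (vtype_of chi v)).
  rewrite ![\sum_(e : hE _) _]big1 // !add0n => /esym/cnt_small.
  case: (posnP (\sum_(w : hV H) _)) => // -> /(_ isT) e0.
  have := @ex_sum_gt0 _ (fun w : hV G => vtype_of chi v == vtype_of chi w) v (eqxx _).
  by rewrite -[X in 0 < X]e0.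
have key g j : v \in hinc G g -> index v (hinc G g) = j ->
    exists2 g', letter_of chi' g' = letter_of chi g &
      (v' \in hinc H g') && (index v' (hinc H g') == j).
  move=> vg vj.
  have jlt : j < max_ar.+1.
    have [_ /(_ g)[_ sg]] := wG.
    by rewrite -vj ltnS (leq_trans (index_size _ _)) // sg leq_max_ar.
  move/eqP: E' => /ffunP/(_ (letter_of chi g, inord j)); rewrite !ffunE => /esym/cnt_small.
  set s := (X in X <= 1 -> _).
  case: (posnP s) => [s0|].
    rewrite {1}s0 => /(_ isT) e0; suff : 0 < s by rewrite s0.
    have {e0} -> : s = _ := e0; apply: (@ex_sum_gt0 _ (fun e => (v \in hinc G e) && _) g).
    by rewrite vg vj eqxx.
  move/(@sum_gt0_ex _ (fun e => (v' \in hinc H e) && _)) => [g' /andP[vg' /eqP gE]] _.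
  have lE := congr1 snd gE; have /= gE1 := congr1 fst gE; rewrite /= in lE.
  exists g' => //; rewrite vg' /=.
  have lt : index v' (hinc H g') < max_ar.+1.
    have [_ /(_ g')[_ sg]] := wH.
    by rewrite ltnS (leq_trans (index_size _ _)) // sg leq_max_ar.
  by rewrite -(inordK lt) -lE inordK.
have [e' e'E e'P] := key _ _ ve vi; have [f' f'E f'P] := key _ _ vf vk.
by exists e', f', v'.
Qed.
End Transfer.
End Types.

(** * Types determine satisfaction *)

Fixpoint quant_depth (S : Type) (p : cmso S) : nat :=
  match p with
  | FNot q => quant_depth q
  | FAnd q r => maxn (quant_depth q) (quant_depth r)
  | FEx1 _ q | FEx2 _ q => (quant_depth q).+1
  | _ => 0
  end.

(* For [m = 0] the predicate [FMod X k m] says that [X] has exactly [k] elements. *)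
Fixpoint mod_bounded (S : Type) (T M : nat) (p : cmso S) : bool :=
  match p with
  | FMod _ k m => if m == 0 then k < T else m %| M.+1
  | FNot q | FEx1 _ q | FEx2 _ q => mod_bounded T M q
  | FAnd q r => mod_bounded T M q && mod_bounded T M r
  | _ => true
  end.

Fixpoint mod_threshold (S : Type) (p : cmso S) : nat :=
  match p with
  | FMod _ k _ => k.+1
  | FNot q | FEx1 _ q | FEx2 _ q => mod_threshold q
  | FAnd q r => maxn (mod_threshold q) (mod_threshold r)
  | _ => 0
  end.

(** The bound [maxn m 1] keeps the product positive; modulus 0 is dealt with by the threshold. *)
Fixpoint mod_modulus (S : Type) (p : cmso S) : nat :=
  match p with
  | FMod _ _ m => maxn m 1
  | FNot q | FEx1 _ q | FEx2 _ q => mod_modulus q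
  | FAnd q r => mod_modulus q * mod_modulus r
  | _ => 1
  end.

Lemma mod_modulus_gt0 (S : Type) (p : cmso S) : 0 < mod_modulus p.
Proof. by elim: p => //= [X k m|q Hq r Hr]; rewrite ?leq_max ?orbT ?muln_gt0 ?Hq. Qed.

Lemma mod_boundedP (S : Type) T M (p : cmso S) :
  mod_threshold p <= T -> mod_modulus p %| M.+1 -> mod_bounded T M p.
Proof.
elim: p => //= [X k [|m]|q Hq r Hr].
- by move=> h _.
- by move=> _; rewrite (maxn_idPl _).
rewrite geq_max => /andP[tq tr] h.
by rewrite Hq ?Hr //; apply: dvdn_trans h; [exact: dvdn_mull|exact: dvdn_mulr].
Qed.

Section Satisfaction.
Variables (Sigma : finType) (arS : Sigma -> nat) (d T M : nat).
Hypothesis T_gt1 : 1 < T.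

Definition marked (G : hgraph Sigma) : hgraph (option Sigma) := mark None (hmap Some G).

(** For arity 0 this is a bijection from the hyperedges of the marked hypergraph to the universe of
    the model, a marker standing for its vertex. *)
Definition model_elt (G : hgraph Sigma) (x : hE (marked G)) : (hV G + hE G)%type :=
  match x with inl e => inr e | inr v => inl (val v) end.

Lemma model_elt_inj G : injective (@model_elt G).
Proof. by move=> [e|v] [e'|v'] // [] => [->//|/val_inj->]. Qed.

Lemma model_elt_surj (G : hgraph Sigma) : hsrc G = [::] ->
  forall y, exists x, @model_elt G x = y.
Proof.
move=> G0 [v|e]; last by exists (inl e).
have h : v \notin hsrc G by rewrite G0.
by exists (inr (exist _ v h)).
Qed.

Lemma hwf_marked (G : hgraph Sigma) : hwf arS G -> hwf (arO arS) (marked G).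
Proof. by move=> wG; apply: hwf_mark. Qed.

(* [rho1] and [rho2] give the colours that stand for the variables in scope; a
   first-order variable is a colour carried by a single hyperedge. *)
Definition coded (j : nat) (rho1 rho2 : nat -> option nat) (G : hgraph Sigma)
    (chi : hE (marked G) -> nat -> bool)
    (r1 : nat -> option (hV G + hE G)%type) (r2 : nat -> {set (hV G + hE G)%type}) : Prop :=
  (forall x, if rho1 x is Some p
    then j <= p < d /\ exists u, r1 x = Some (model_elt u) /\ forall e, chi e p = (e == u)
    else r1 x = None) /\
  (forall X, if rho2 X is Some p
    then j <= p < d /\ forall e, chi e p = (model_elt e \in r2 X)
    else r2 X = set0).

Definition colour (c : letter Sigma d) (p : nat) : bool :=
  if insub p is Some i then c.2 i else false.

Lemma colour_of G (chi : hE G -> nat -> bool) e p : p < d ->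
  colour (letter_of d chi e) p = chi e p.
Proof. by move=> pd; rewrite /colour insubT /= ffunE. Qed.

Lemma coded_agree j i rho1 rho2 G chi chi1 r1 r2 : i <= j ->
  (forall e p, j <= p -> chi1 e p = chi e p) ->
  @coded j rho1 rho2 G chi r1 r2 -> @coded i rho1 rho2 G chi1 r1 r2.
Proof.
move=> ij c1 [H1 H2]; split=> x.
  case: (rho1 x) (H1 x) => // p [/andP[jp pd] [u [ru cu]]].
  split; first by rewrite pd (leq_trans ij).
  by exists u; split=> // e; rewrite c1.
case: (rho2 x) (H2 x) => // p [/andP[jp pd] cu].
by split=> [|e]; [rewrite pd (leq_trans ij) | rewrite c1].
Qed.

Lemma coded_upd1 j rho1 rho2 G chi r1 r2 x u : j < d ->
  @coded j.+1 rho1 rho2 G chi r1 r2 ->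
  coded j (upd rho1 x (Some j)) rho2 (fun e => upd (chi e) j (e == u))
    (upd r1 x (Some (model_elt u))) r2.
Proof.
move=> jd /(coded_agree (i := j) (chi1 := fun e => upd (chi e) j (e == u)) (leqnSn j)).
case=> [e p jp|H1 H2]; first by rewrite /upd gtn_eqF.
split=> // y; rewrite /upd; case: eqP => [_|_]; last exact: H1.
by rewrite leqnn jd; split=> //; exists u; split=> // e; rewrite eqxx.
Qed.

Lemma coded_upd2 j rho1 rho2 G chi r1 r2 X (U : {set hV G + hE G}) : j < d ->
  @coded j.+1 rho1 rho2 G chi r1 r2 ->
  coded j rho1 (upd rho2 X (Some j)) (fun e => upd (chi e) j (model_elt e \in U))
    r1 (upd r2 X U).
Proof.
move=> jd /(coded_agree (i := j) (chi1 := fun e => upd (chi e) j (model_elt e \in U)) (leqnSn j)).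
case=> [e p jp|H1 H2]; first by rewrite /upd gtn_eqF.
split=> // y; rewrite /upd; case: eqP => [_|_]; last exact: H2.
by rewrite leqnn jd; split=> // e; rewrite eqxx.
Qed.

(** * Equal types preserve atomic formulas *)

Section Atoms.
Variables (G H : hgraph Sigma).
Hypotheses (wG : hwf arS G) (G0 : hsrc G = [::]) (wH : hwf arS H) (H0 : hsrc H = [::]).
Variables (j : nat) (rho1 rho2 : nat -> option nat).
Variables (chi : hE (marked G) -> nat -> bool) (chi' : hE (marked H) -> nat -> bool).
Variables (r1 : nat -> option (hV G + hE G)%type) (r2 : nat -> {set (hV G + hE G)%type}).
Variables (s1 : nat -> option (hV H + hE H)%type) (s2 : nat -> {set (hV H + hE H)%type}).
Hypotheses (cG : coded j rho1 rho2 chi r1 r2) (cH : coded j rho1 rho2 chi' s1 s2).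
Hypothesis E : type arS d T M j chi = type arS d T M j chi'.

Let mG : hwf (arO arS) (marked G) := hwf_marked wG.
Let mH : hwf (arO arS) (marked H) := hwf_marked wH.

(** Carrying two given colours and a label of a given kind is a property of one letter. This single
    fact serves the membership, equality and label atoms. *)
Lemma type_ex (L : option Sigma -> bool) p q e : j <= p < d -> j <= q < d ->
  L (hlab (marked G) e) -> chi e p -> chi e q ->
  exists e', [/\ L (hlab (marked H) e'), chi' e' p & chi' e' q].
Proof.
move=> /andP[jp pd] /andP[jq qd] Le ep eq.
have [chi1 [chi1' [c1 c1' E1]]] := type_descend mG mH E.
have [] := @type0_ex _ _ _ _ _ _ _ _ _ mG G0 mH H0 E1 T_gt1
  (fun c => [&& L c.1, colour c p & colour c q]) e.
  by rewrite /= !colour_of // !c1 // Le ep.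
move=> e' /=; rewrite !colour_of // !c1' // => /and3P[Le' ep' eq'].
by exists e'.
Qed.

Lemma type_count p : j <= p < d ->
  cnt T M #|[pred e | chi e p]| = cnt T M #|[pred e | chi' e p]|.
Proof.
move=> /andP[jp pd].
have [chi1 [chi1' [c1 c1' E1]]] := type_descend mG mH E.
have := @type0_count _ _ _ _ _ _ _ _ _ mG G0 mH H0 E1 (fun c => colour c p).
rewrite (@eq_card _ [pred e | colour _ p] [pred e | chi e p]); last first.
  by move=> e; rewrite !inE colour_of // c1.
by rewrite (@eq_card _ [pred e | colour _ p] [pred e | chi' e p]) // => e;
  rewrite !inE colour_of // c1'.
Qed.

Lemma type_incidence p q e f v i : j <= p < d -> j <= q < d ->
  chi (inl e) p -> chi (inr f) q -> v \in hinc G e -> index v (hinc G e) = i ->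
  v = val f ->
  exists e' f', [/\ chi' (inl e') p, chi' (inr f') q,
     val f' \in hinc H e' & index (val f') (hinc H e') = i].
Proof.
move=> /andP[jp pd] /andP[jq qd] ep fq ve vi vf.
have [chi1 [chi1' [c1 c1' E1]]] := type_descend mG mH E.
have vf1 : v \in hinc (marked G) (inr f) by rewrite /= vf inE.
have vf0 : index v (hinc (marked G) (inr f)) = 0 by rewrite /= vf eqxx.
have [e' [f' [v' [eE fE /andP[ve' /eqP vi'] /andP[vf' _]]]]] :=
  @type0_incidence _ _ _ _ _ _ _ _ _ mG G0 mH H0 E1 T_gt1 (inl e) (inr f) v i 0 ve vi vf1 vf0.
(* Letters tell original hyperedges ([Some]) from markers ([None]), so [e'] is original and, below,
   [f'] is a marker, whose only vertex is then [v']. *)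
case: e' eE ve' vi' => [e'|w] eE ve' vi'; last by have := congr1 fst eE.
case: f' fE vf' => [g|f'] fE vf'; first by have := congr1 fst fE.
exists e', f'; move: vf'; rewrite /= inE => /eqP vf'; rewrite -vf'; split=> //.
  by rewrite -c1' // -(colour_of _ _ pd) eE colour_of // c1.
by rewrite -c1' // -(colour_of _ _ qd) fE colour_of // c1.
Qed.

Lemma sat_atom_in x X : sat r1 r2 (FIn Sigma x X) -> sat s1 s2 (FIn Sigma x X).
Proof.
case: cG cH => G1 G2 [H1 H2] /=.
move: (G1 x) (H1 x); case: (rho1 x) => [p|-> //] [jp [u [-> cu]]] [_ [u' [-> cu']]].
move: (G2 X) (H2 X); case: (rho2 X) => [q|->]; last by rewrite inE.
move=> [jq cq] [_ cq'] uX.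
have [||e' [_]] := @type_ex predT p q u jp jq isT.
- by rewrite cu.
- by rewrite cq.
by rewrite cu' cq' => /eqP->.
Qed.

Lemma sat_atom_eq x y : sat r1 r2 (FEq Sigma x y) -> sat s1 s2 (FEq Sigma x y).
Proof.
case: cG cH => G1 G2 [H1 H2] /=.
move: (G1 x) (H1 x); case: (rho1 x) => [p|-> //] [jp [u [-> cu]]] [_ [u' [-> cu']]].
move: (G1 y) (H1 y); case: (rho1 y) => [q|-> //] [jq [w [-> cw]]] [_ [w' [-> cw']]].
case=> /model_elt_inj wu; rewrite wu in cw.
have [||e' [_]] := @type_ex predT p q u jp jq isT.
- by rewrite cu.
- by rewrite cw.
by rewrite cu' cw' => /eqP-> /eqP->.
Qed.

Lemma sat_atom_lab a x : sat r1 r2 (FLab a x) -> sat s1 s2 (FLab a x).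
Proof.
case: cG cH => G1 G2 [H1 H2] /=.
move: (G1 x) (H1 x); case: (rho1 x) => [p|-> //] [jp [u [-> cu]]] [_ [u' [-> cu']]].
case: u cu => //= e cu ea.
have [|||e' [Le]] := @type_ex (pred1 (Some a)) p p (inl e) jp jp.
- by rewrite /= ea.
- by rewrite cu.
- by rewrite cu.
rewrite cu' => /eqP eu _; rewrite {}eu in Le *.
by case: u' Le {cu'} => //= e1 /eqP[].
Qed.

Lemma sat_atom_inc i x y : sat r1 r2 (FInc Sigma i x y) -> sat s1 s2 (FInc Sigma i x y).
Proof.
case: cG cH => G1 G2 [H1 H2] /=.
move: (G1 x) (H1 x); case: (rho1 x) => [p|-> //] [jp [u [-> cu]]] [_ [u' [-> cu']]].
move: (G1 y) (H1 y); case: (rho1 y) => [q|-> _]; last first.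
  by case: u cu.
move=> [jq [w [-> cw]]] [_ [w' [-> cw']]].
case: u cu => //= e cu; case: w cw => //= f cw [i0 nE].
have [_ /(_ e)[ue _]] := wG.
have lt : i.-1 < size (hinc G e).
  by rewrite ltnNge; apply/negP => le; rewrite nth_default ?size_map in nE.
have fE : val f = nth (val f) (hinc G e) i.-1.
  by move: nE; rewrite (nth_map (val f)) // => -[->].
have fe : val f \in hinc G e by rewrite fE mem_nth.
have fi : index (val f) (hinc G e) = i.-1 by rewrite fE index_uniq.
have [||e' [f' [ep fq fe' fi']]] := @type_incidence p q e f (val f) i.-1 jp jq _ _ fe fi erefl.
- by rewrite cu.
- by rewrite cw.
move: ep fq; rewrite cu' cw' => /eqP<- /eqP<- /=; split=> //.
by rewrite (nth_map (val f')) -?fi' ?index_mem // nth_index.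
Qed.

Lemma sat_atom_mod X k m : mod_bounded T M (FMod Sigma X k m) ->
  sat r1 r2 (FMod Sigma X k m) -> sat s1 s2 (FMod Sigma X k m).
Proof.
have cardE (K : hgraph Sigma) (A : {set (hV K + hE K)}) (B : pred (hE (marked K))) :
    hsrc K = [::] -> (forall e, B e = (model_elt e \in A)) -> #|A| = #|B|.
  move=> K0 BA; rewrite -(card_image (@model_elt_inj K)).
  apply: eq_card => y; apply/idP/imageP => [yA|[e]]; last by move=> Be ->; rewrite -BA.
  have [e ey] := model_elt_surj K0 y; exists e => //.
  by rewrite unfold_in BA ey.
case: cG cH => G1 G2 [H1 H2] /=.
move: (G2 X) (H2 X); case: (rho2 X) => [q|-> ->]; last by rewrite !cards0.
move=> [jq cq] [_ cq'].
rewrite (cardE _ _ [pred e | chi e q] G0 cq) (cardE _ _ [pred e | chi' e q] H0 cq').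
case/cnt_eq: (type_count jq) => [->//|[Ta Tb ab]].
(* Both sizes are now at least [T] and congruent modulo [M.+1]. For [m = 0] the size would be
   [k < T], a contradiction; otherwise [m] divides [M.+1]. *)
case: eqP => [-> kT|_ mM] e.
  by move: e Ta; rewrite !modn0 => ->; rewrite leqNgt kT.
by rewrite -e -(modn_dvdm _ mM) -ab modn_dvdm.
Qed.
End Atoms.

(** One implication suffices, since the assumptions are symmetric in [G] and [H]: negation swaps the
    two. A quantifier consumes one level and colours its witness with the new colour [j]. *)
Lemma sat_type p : mod_bounded T M p -> forall j, quant_depth p <= j -> j <= d ->
  forall (G H : hgraph Sigma), hwf arS G -> hsrc G = [::] -> hwf arS H -> hsrc H = [::] ->
  forall rho1 rho2 chi chi' r1 r2 s1 s2,
  @coded j rho1 rho2 G chi r1 r2 -> @coded j rho1 rho2 H chi' s1 s2 ->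
  type arS d T M j chi = type arS d T M j chi' -> sat r1 r2 p -> sat s1 s2 p.
Proof.
elim: p => [x X|x y|a x|i x y|X k m|q IH|q IHq r IHr|x q IH|X q IH].
- move=> _ j _ _ G H wG G0 wH H0 rho1 rho2 chi chi' r1 r2 s1 s2 cG cH E.
  exact: (sat_atom_in wG G0 wH H0 cG cH E).
- move=> _ j _ _ G H wG G0 wH H0 rho1 rho2 chi chi' r1 r2 s1 s2 cG cH E.
  exact: (sat_atom_eq wG G0 wH H0 cG cH E).
- move=> _ j _ _ G H wG G0 wH H0 rho1 rho2 chi chi' r1 r2 s1 s2 cG cH E.
  exact: (sat_atom_lab wG G0 wH H0 cG cH E).
- move=> _ j _ _ G H wG G0 wH H0 rho1 rho2 chi chi' r1 r2 s1 s2 cG cH E.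
  exact: (sat_atom_inc wG G0 wH H0 cG cH E).
- move=> b j _ _ G H wG G0 wH H0 rho1 rho2 chi chi' r1 r2 s1 s2 cG cH E.
  exact: (sat_atom_mod wG G0 wH H0 cG cH E b).
- move=> b j qj jd G H wG G0 wH H0 rho1 rho2 chi chi' r1 r2 s1 s2 cG cH E /= ns s.
  by apply: ns; apply: (IH b j qj jd H G wH H0 wG G0 _ _ _ _ _ _ _ _ cH cG) s.
- move=> /= /andP[bq br] j; rewrite geq_max => /andP[qj rj] jd G H wG G0 wH H0.
  move=> rho1 rho2 chi chi' r1 r2 s1 s2 cG cH E [sq sr].
  split; first exact: (IHq bq j qj jd G H wG G0 wH H0 _ _ _ _ _ _ _ _ cG cH E sq).
  exact: (IHr br j rj jd G H wG G0 wH H0 _ _ _ _ _ _ _ _ cG cH E sr).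
- move=> /= b [|j] //; rewrite ltnS => qj jd G H wG G0 wH H0.
  move=> rho1 rho2 chi chi' r1 r2 s1 s2 cG cH E [y s].
  have [u uy] := model_elt_surj G0 y.
  have [U' E'] := type_step (hwf_marked wG) (hwf_marked wH) E (fun e => e == u).
  (* The answer to a singleton has the same truncated count 1, hence is a singleton and names an
     element. *)
  have [u' u'E] : exists u', forall e, U' e = (e == u').
    have jj : j <= j < d by rewrite leqnn.
    have := type_count wG G0 wH H0 E' jj.
    rewrite (@eq_card _ _ (pred1 u)) ?card1; last first.
      by move=> e; rewrite !inE /upd eqxx.
    move/(cnt_small T_gt1)/(_ isT)/esym => c1.
    have [u' u'E] := mem_card1 c1; exists u' => e.
    by have := u'E e; rewrite !inE /upd eqxx.
  have U'E : U' = fun e => e == u' by apply: funext.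
  rewrite {}U'E in E'; exists (model_elt u').
  have cG' := coded_upd1 x u jd cG; rewrite uy in cG'.
  have cH' := coded_upd1 x u' jd cH.
  exact: (IH b j qj (ltnW jd) G H wG G0 wH H0 _ _ _ _ _ _ _ _ cG' cH' E' s).
- move=> /= b [|j] //; rewrite ltnS => qj jd G H wG G0 wH H0.
  move=> rho1 rho2 chi chi' r1 r2 s1 s2 cG cH E [U s].
  have [U' E'] := type_step (hwf_marked wG) (hwf_marked wH) E (fun e => model_elt e \in U).
  pose V := [set model_elt e | e in U'].
  have VE : U' = fun e => model_elt e \in V.
    by apply: funext => e; rewrite (mem_imset _ _ (@model_elt_inj H)).
  rewrite {}VE in E'; exists V.
  have cG' := coded_upd2 X U jd cG; have cH' := coded_upd2 X V jd cH.
  exact: (IH b j qj (ltnW jd) G H wG G0 wH H0 _ _ _ _ _ _ _ _ cG' cH' E' s).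
Qed.
End Satisfaction.

Theorem theorem4p24 (Sigma : finType) (arS : Sigma -> nat) (L : hgraph Sigma -> Prop) :
  cmso2_definable arS L ->
  exists (A : Type) (ar : A -> nat) (pi : hgraph A -> A),
    is_Halg ar pi /\ Halg_computable ar pi /\ finite_on_every_arity ar /\
    recognises arS L ar pi.
Proof.
case=> p Lp.
(* The 2 makes singletons recognisable; [M] is a predecessor because counting is done modulo
   [M.+1]. *)
pose d := quant_depth p; pose T := maxn 2 (mod_threshold p); pose M := (mod_modulus p).-1.
have T_gt1 : 1 < T by rewrite leq_maxl.
have bp : mod_bounded T M p.
  by apply: mod_boundedP; rewrite ?leq_maxr // prednK // mod_modulus_gt0.
pose none : nat -> bool := fun=> false.
pose u := colour_elt arS d T M d None none.
have ar_u : car_ar u = 1 by rewrite colour_elt_ar.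
pose B := mark_calg ar_u.
pose a s : B := colour_elt arS d T M d (Some s) none.
have aP s : car_ar (a s) = arS s by apply: colour_elt_ar.
exists B, (@car_ar B), (@car_pi B).
split; first exact: car_alg.
split; first exact: calg_computable.
split; first exact: calg_finite.
pose h (G : hgraph Sigma) : B := car_pi (hmap a G).
exists h; split; first exact: hom_of_letters (car_alg B) aP.
(* The product of [B] inserts markers labelled [u], which is the element of the letter [None]; so
   the homomorphism computes the type of the marked hypergraph with no colour assigned. *)
have hE (G : hgraph Sigma) : h G = type arS d T M d (G := marked G) (fun=> none).
  rewrite /h /= /mark_pi /type; congr car_pi; congr HG.
  by apply: funext => -[].
(* The accepting set is the image of [L]; it remains to see that hypergraphs with equal values agree
   on the sentence. *)
exists (fun x => exists G, [/\ hwf arS G, harity G = 0, h G = x & L G]) => G wG G0.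
split=> [LG|[H [wH H0 hH LH]]]; first by exists G.
apply/(Lp G wG G0); move/(Lp H wH H0): LH.
have c0 (K : hgraph Sigma) : coded d d (fun=> None) (fun=> None) (G := K) (fun=> none)
  (fun=> None) (fun=> set0) by split.
by apply: (sat_type T_gt1 bp (leqnn d) (leqnn d) wH (size0nil H0) wG (size0nil G0)
  (c0 H) (c0 G)); rewrite -!hE.
Qed.
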